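(* Let $X$ be a real-valued random variable that is symmetric (i.e. $-X$ has the same law as $X$), has unit variance, satisfies $\mathbb{E}[X^4]<\infty$, and whose law satisfies Assumption 1 with parameters $h,w\in(0,1]$. Let $N\ge 1$ be an integer and let $X_1,\ldots,X_N$ be independent random variables, each distributed like $X$. Let $G$ be a standard Gaussian random variable. Then $$\mathrm{d}_{\mathrm{KS}}\left(\frac{X_1+\cdots+X_N}{\sqrt N},\,G\right)\le 3\left\{\frac{\mathbb{E}[X^4]}{N}+\exp\left(-\frac{1}{160}\,\frac{h w^3 N}{\mathbb{E}[X^4]}\right)\right\}.$$
   Context: For real-valued random variables $Y,Z$, the Kolmogorov-Smirnov distance is $\mathrm{d}_{\mathrm{KS}}(Y,Z):=\sup_{s\in\mathbb{R}}|\mathbb{P}(Y\le s)-\mathbb{P}(Z\le s)|$. Assumption 1 (with parameters $h,w$, where $0<h\le 1$ and $0<w\le 1$) on a probability measure $\mu$ on $\mathbb{R}$: write $\mu=\mu_d+\mu'$ for the Lebesgue decomposition, with $\mu_d$ absolutely continuous with respect to Lebesgue measure and $\mu'$ singular, and let $f:\mathbb{R}\to[0,\infty)$ be the density of $\mu_d$. Then there is some $a\in\mathbb{R}$ such that $f(s)\ge h$ for all $s\in[a,a+w)$. *)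

(* Defs.v *)
From HB Require Import structures.
From mathcomp Require Import all_boot all_order all_algebra.
From mathcomp Require Import all_classical all_reals all_analysis measurable_realfun.
Set Implicit Arguments.
Unset Strict Implicit.
Unset Printing Implicit Defensive.
Import Order.TTheory GRing.Theory Num.Theory.
Import numFieldNormedType.Exports.
Local Open Scope classical_set_scope.
Local Open Scope ring_scope.

Definition ks_dist (R : realType) (d d' : measure_display)
    (T : measurableType d) (T' : measurableType d')
    (P : probability T R) (Q : probability T' R)
    (Y : {RV P >-> R}) (Z : {RV Q >-> R}) : R :=
  sup [set `|fine (cdf Y s) - fine (cdf Z s)| | s in [set: R]].

Definition same_law (R : realType) (d d' : measure_display)
    (T : measurableType d) (T' : measurableType d')
    (P : probability T R) (Q : probability T' R)
    (Y : {RV P >-> R}) (Z : {RV Q >-> R}) : Prop :=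
  forall A : set R, measurable A -> distribution P Y A = distribution Q Z A.

Definition symmetric_rv (R : realType) (d : measure_display)
    (T : measurableType d) (P : probability T R) (X : {RV P >-> R}) : Prop :=
  same_law (- (X : {mfun T >-> R}) : {RV P >-> R}) X.

Definition standard_gaussian (R : realType) (d : measure_display)
    (T : measurableType d) (P : probability T R) (G : {RV P >-> R}) : Prop :=
  forall A : set R, measurable A -> distribution P G A = normal_prob 0 1 A.

Definition independent_rvs (R : realType) (d : measure_display)
    (T : measurableType d) (P : probability T R) (N : nat)
    (X : 'I_N -> {RV P >-> R}) : Prop :=
  forall (J : {set 'I_N}) (B : 'I_N -> set R),
    (forall i, measurable (B i)) ->
    P (\bigcap_(i in [set` J]) X i @^-1` B i)
      = (\prod_(i in J) P (X i @^-1` B i))%E.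

Definition normalized_sum (R : realType) (d : measure_display)
    (T : measurableType d) (P : probability T R) (N : nat)
    (X : 'I_N -> {RV P >-> R}) : {RV P >-> R} :=
  (Num.sqrt N%:R)^-1 *: \sum_(i < N) (X i : {mfun T >-> R}).

Definition mutually_singular (R : realType) (d : measure_display)
    (T : measurableType d) (mu nu : set T -> \bar R) : Prop :=
  exists2 A : set T, measurable A & mu A = 0%E /\ nu (~` A) = 0%E.

Definition lebesgue_decomposition (R : realType)
    (mu mud mus : {measure set R -> \bar R}) : Prop :=
  [/\ mud `<< (lebesgue_measure : set R -> \bar R),
      mutually_singular mus (lebesgue_measure : set R -> \bar R) &
      forall A : set R, measurable A -> mu A = (mud A + mus A)%E].

Definition is_density (R : realType) (nu : {measure set R -> \bar R})
    (f : R -> R) : Prop :=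
  [/\ measurable_fun setT f, (forall s, 0 <= f s) &
      forall A : set R, measurable A ->
        nu A = (\int[lebesgue_measure]_(x in A) (f x)%:E)%E].

(* A density is determined only up to Lebesgue-null sets, so the pointwise lower
   bound is required of some version f of the density of mud. *)
Definition assumption1 (R : realType) (h w : R)
    (mu : probability R R) : Prop :=
  exists (mud mus : {measure set R -> \bar R}) (f : R -> R),
    [/\ lebesgue_decomposition mu mud mus, is_density mud f &
        exists a : R, forall s, s \in `[a, a + w[ -> h <= f s].

(* Main.v *)
Require Import Defs.
From HB Require Import structures.
From mathcomp Require Import all_boot all_order all_algebra.
From mathcomp Require Import all_classical all_reals all_analysis measurable_realfun.
From mathcomp Require Import ring lra.
Import Order.TTheory GRing.Theory Num.Theory.
Import numFieldNormedType.Exports.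
Set Implicit Arguments.
Unset Strict Implicit.
Unset Printing Implicit Defensive.
Local Open Scope classical_set_scope.
Local Open Scope ring_scope.

(** The proof is a Fourier argument. Because the law mu of X is symmetric, its
    characteristic function is the real function phi(u) = E cos(u X), and so is
    that of the normalized sum S, which by independence is phi(t / sqrt N) ^ N.
    Write m = E X^4, which is at least 1, and K = h w^3 N / (160 m). If
    N <= 3 m the right-hand side exceeds 1 and there is nothing to prove, so let
    3 m < N.

    Near the origin, that is for m u^2 < 2, Taylor expansion of the cosine gives
    1 - u^2/2 <= phi(u) <= 1 - u^2/2 + m u^4/24, so that phi(u) and
    exp(- u^2/2) differ by O(m u^4) and are both at most exp(- 5 u^2/12);
    hence their N-th powers are close. Away from the origin, for m u^2 >= 2, the part
    of the law that dominates h times Lebesgue measure on an interval of length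
    w keeps |phi(u)| below 1: an explicit integration of the cosine on this
    interval gives |phi(u)| <= exp(- 3 h w^3/(160 m)), whose N-th power is
    exp(- 3 K). Both cases are contained in one inequality [chf_power_close],

      |E cos(t S) - exp(- t^2/2)| <= t * ((m/N) t exp(- t^2/8) + exp(- 3 K)).

    To pass from characteristic functions to distribution functions, convolve
    the laws with the Cauchy law of scale e = exp(- 2 K). The smoothed
    distribution function is the expectation of 1/2 + atan((s - S)/e)/pi, and
    since atan(x/e) is the integral over t > 0 of exp(- e t) sin(t x)/t, the
    smoothed distribution functions of S and of the normal law differ by at most
    1/pi times the integral of exp(- e t) |E cos(t S) - exp(- t^2/2)|/t
    [smoothed_cdf_dist], that is, by at most (4 m/N + exp(- 3 K)/e)/pi. The factor
    exp(- e t) is what makes the second term integrable; it becomes exp(- K).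

    Removing the smoothing with a shift eta = exp(- K) costs 2 e/(eta pi), from
    the Cauchy tails, and 2 eta times a Lipschitz constant of the normal
    distribution function, for which 1/2 will do [cdf_dist_le_smoothed]. As
    pi >= 2, the total is at most 2 m/N + (5/2) exp(- K)
    [ks_standard_normal]. *)

(** * Elementary inequalities *)

Lemma ge0_derive_ge_at0 (R : realType) (f f' : R -> R) (x : R) :
    (forall y, is_derive y (1 : R) f (f' y)) -> (forall y, 0 <= y -> 0 <= f' y) ->
  0 <= x -> f 0 <= f x.
Proof.
move=> df f'0 x0.
have fD y : derivable f y 1 by exact: (@ex_derive _ _ _ _ _ _ _ (df y)).
apply: (@ger0_derive1_ndecry R f 0) => //.
- move=> y; rewrite in_itv/= andbT => /ltW y0.
  by rewrite derive1E (@derive_val _ _ _ _ _ _ _ (df y)) f'0.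
- exact: derivable_within_continuous.
Qed.

Lemma sin_le_id (R : realType) (x : R) : 0 <= x -> sin x <= x.
Proof.
move=> x0.
have d (y : R) : is_derive y (1 : R) (fun x : R => x - sin x) (1 - cos y).
  by apply: is_derive_eq.
have := ge0_derive_ge_at0 d _ x0; rewrite sin0 subr0 (subr_ge0 (sin x)); apply.
by move=> y _; rewrite subr_ge0 cos_le1.
Qed.

Lemma normr_sin_le (R : realType) (x : R) : `|sin x| <= `|x|.
Proof.
wlog x0 : x / 0 <= x.
  move=> H; have [/H//|x0] := leP 0 x.
  by have := H (- x); rewrite sinN !normrN oppr_ge0; apply; exact: ltW.
rewrite (ger0_norm x0) ler_norml sin_le_id// andbT.
have [x1|x1] := leP x 1.
  rewrite (@le_trans _ _ 0) ?oppr_le0// sin_ge0_pi// x0/=.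
  by rewrite (le_trans x1)// (le_trans _ (pi_ge2 R))// ler1n.
by rewrite (le_trans _ (sin_geN1 _))// lerN2 ltW.
Qed.

Lemma cos_1Bsin2 (R : realType) (x : R) : cos x = 1 - 2 * sin (x / 2) ^+ 2.
Proof.
rewrite {1}(_ : x = (x / 2) *+ 2) ?cos_mulr2n ?cos2sin2; last by rewrite mulr2n; field.
by rewrite mulr2n; ring.
Qed.

Lemma cos_ge_1Bsqr (R : realType) (x : R) : 1 - x ^+ 2 / 2 <= cos x.
Proof.
rewrite cos_1Bsin2 lerD2l lerN2.
have : `|sin (x / 2)| ^+ 2 <= `|x / 2| ^+ 2.
  by rewrite ler_pXn2r ?nnegrE// normr_sin_le.
rewrite !real_normK ?num_real//; nra.
Qed.

(** The derivative of the difference is nonnegative by [cos_ge_1Bsqr]: each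
    Taylor bound is obtained from the previous one. *)
Lemma sin_ge_idBcube (R : realType) (x : R) : 0 <= x -> x - x ^+ 3 / 6 <= sin x.
Proof.
move=> x0.
have d (y : R) : is_derive y (1 : R) (fun x : R => sin x - (x - x ^+ 3 / 6))
    (cos y - (1 - y ^+ 2 / 2)).
  by apply: is_derive_eq; rewrite /GRing.scale/= !mulr1 !mulr0; field.
have := ge0_derive_ge_at0 d _ x0.
rewrite sin0 expr0n/= mul0r !subr0 (subr_ge0 (x - _)); apply.
by move=> y _; rewrite subr_ge0 cos_ge_1Bsqr.
Qed.

(** In terms of y = x/2 the claim is a lower bound for sin(y)^2, which follows by
    squaring [sin_ge_idBcube] as long as y - y^3/6 is nonnegative; for y^2 > 3 the
    right-hand side is at least 1. *)
Lemma cos_le_taylor4 (R : realType) (x : R) :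
  cos x <= 1 - x ^+ 2 / 2 + x ^+ 4 / 24.
Proof.
wlog x0 : x / 0 <= x.
  move=> H; have [/H//|x0] := leP 0 x.
  have := H (- x); rewrite cosN oppr_ge0 ltW// => /(_ isT).
  by rewrite sqrrN (_ : (- x) ^+ 4 = x ^+ 4)//; ring.
rewrite cos_1Bsin2; set y := x / 2.
have -> : x = 2 * y by rewrite /y; field.
have y0 : 0 <= y by rewrite divr_ge0.
(* beyond y^2 = 3 the polynomial 1 - 2 y^2 + 2 y^4 / 3 is at least 1 *)
have [y3|y3] := leP (y ^+ 2) 3; last first.
  have := sqr_ge0 (sin y); nra.
have := sin_ge_idBcube y0.
have h : 0 <= y - y ^+ 3 / 6 by nra.
move=> h1; have : (y - y ^+ 3 / 6) ^+ 2 <= sin y ^+ 2.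
  by rewrite ler_pXn2r// nnegrE// (le_trans h).
have : 0 <= y ^+ 6 by rewrite exprn_ge0.
lra.
Qed.

(** The double angle formula; the factor cos(v/2) is the gain over |sin v| <= v
    exploited in [sinc_le]. *)
Lemma normr_sin_le_cos_half (R : realType) (v : R) : 0 <= v ->
  `|sin v| <= v * `|cos (v / 2)|.
Proof.
move=> v0; have -> : `|sin v| = `|cos (v / 2)| * `|sin (v / 2)| * 2.
  rewrite -normrM mulr_natr -normrMn -sin_mulr2n.
  by congr (`|sin _|); rewrite mulr2n; field.
have := normr_sin_le (v / 2); rewrite (ger0_norm (divr_ge0 v0 _))// => h.
have := normr_ge0 (cos (v / 2)); nra.
Qed.

(** A quantitative form of |sin v| < v. The constant 3/80 is small enough for the
    fourth order bound on cos(v/2) to give it for v <= 2, and for |sin v| <= 1 to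
    give it beyond. *)
Lemma sinc_le (R : realType) (c v : R) : 0 <= c -> c <= 1 / 2 -> c <= v ^+ 2 -> 0 < v ->
  `|sin v| <= v * (1 - 3 * c / 80).
Proof.
move=> c0 c1 cv v0.
have [v2|v2] := leP v 2; last first.
  have : `|sin v| <= 1 by exact: sin_max.
  nra.
apply: le_trans (normr_sin_le_cos_half (ltW v0)) _.
rewrite ler_pM2l//.
have h1 := cos_ge_1Bsqr (v / 2); have h2 := cos_le_taylor4 (v / 2).
have v4 : v ^+ 2 <= 4 by nra.
rewrite ger0_norm; last by nra.
apply: le_trans h2 _.
have -> : (v / 2) ^+ 4 = v ^+ 2 * v ^+ 2 / 16 by field.
nra.
Qed.

Lemma expRN_le_taylor2 (R : realType) (x : R) : 0 <= x -> expR (- x) <= 1 - x + x ^+ 2 / 2.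
Proof.
move=> x0.
have d (y : R) : is_derive y (1 : R) (fun x : R => 1 - x + x ^+ 2 / 2 - expR (- x))
    (-1 + y + expR (- y)).
  by apply: is_derive_eq; rewrite /GRing.scale/=; field.
have := ge0_derive_ge_at0 d _ x0.
have -> : 1 - 0 + 0 ^+ 2 / 2 - expR (- 0) = 0 :> R by rewrite oppr0 expR0; ring.
rewrite (subr_ge0 (expR _)).
by apply=> y _; have := expR_ge1Dx (- y); lra.
Qed.

(** Factor a ^ n - b ^ n by the geometric sum and bound its terms by c ^ n.-1. *)
Lemma normr_subX_le (R : realDomainType) (a b c : R) n : `|a| <= c -> `|b| <= c ->
  `|a ^+ n - b ^+ n| <= n%:R * c ^+ n.-1 * `|a - b|.
Proof.
move=> ac bc; rewrite subrXX normrM mulrC ler_wpM2r//.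
have c0 : 0 <= c := le_trans (normr_ge0 _) ac.
apply: le_trans (ler_norm_sum _ _ _) _.
rewrite [leRHS](_ : _ = \sum_(i < n) c ^+ n.-1); last first.
  by rewrite sumr_const card_ord mulr_natl.
apply: ler_sum => i _; rewrite normrM !normrX.
rewrite [in leRHS](_ : n.-1 = ((n.-1 - i) + i)%N); last first.
  by rewrite subnK// -ltnS prednK// (leq_ltn_trans _ (ltn_ord i)).
by rewrite exprD ler_pM ?exprn_ge0// ?subn1 ?lerXn2r// ?nnegrE ?(le_trans _ ac)//
  -?subn1 -?subnDA ?addn1// ?add1n// lerXn2r// nnegrE.
Qed.

(** * Integrals determined by their values on indicators *)

Section weighted_change_of_variables.
Context d d' (T : measurableType d) (Y : measurableType d') (R : realType).
Variables (m : {measure set T -> \bar R}) (p : T -> R) (phi : T -> Y).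
Hypotheses (mp : measurable_fun setT p) (p0 : forall x, 0 <= p x).
Hypothesis mphi : measurable_fun setT phi.
Import HBNNSimple.

(** A measure with density p, pushed forward along phi, is handled through the
    integrals of p x * f (phi x), with no measure constructed for it. This form
    covers at once densities, image measures and independence. *)
Lemma integral_weighted_nnsfun (g : {nnsfun Y >-> R}) :
  (\int[m]_x (p x * g (phi x))%:E =
   \sum_(k \in range g) (k%:E * \int[m]_x (p x * \1_(g @^-1` [set k]) (phi x))%:E))%E.
Proof.
under eq_integral do rewrite fimfunE fsbig_finite//= mulr_sumr -sumEFin.
have mk k : measurable_fun setT (fun x => p x * \1_(g @^-1` [set k]) (phi x)).
  apply: measurable_funM => //; apply: measurableT_comp => //.
have k0 k x : 0 <= k * \1_(g @^-1` [set k]) (phi x).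
  by rewrite -lee_fin EFinM nnfun_muleindic_ge0.
have e k x : p x * (k * \1_(g @^-1` [set k]) (phi x)) =
    k * (p x * \1_(g @^-1` [set k]) (phi x)) by ring.
rewrite ge0_integral_sum//; last 2 first.
- move=> k; apply/measurable_EFinP; under eq_fun do rewrite e.
  exact: measurable_funM.
- by move=> k x _; rewrite lee_fin mulr_ge0.
rewrite fsbig_finite//=; apply: eq_bigr => k _.
under eq_integral do rewrite e EFinM.
have [kneg|kpos] := ltP k 0; last first.
  rewrite ge0_integralZl//; first exact/measurable_EFinP.
  by move=> x _; rewrite lee_fin mulr_ge0.
rewrite !integral0_eq ?mule0// => x _; rewrite preimage_nnfun0// indicE in_set0 ?mulr0//.
by rewrite mule0.
Qed.

Lemma cvg_integral_weighted_approx (f : Y -> R) (mf : measurable_fun setT (EFin \o f)) :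
    (forall y, 0 <= f y) ->
  (\int[m]_x (p x * nnsfun_approx measurableT mf n (phi x))%:E @[n --> \oo]
     --> \int[m]_x (p x * f (phi x))%:E)%E.
Proof.
move=> f0.
have mg n : measurable_fun setT
    (fun x => (p x * nnsfun_approx measurableT mf n (phi x))%:E).
  by apply/measurable_EFinP; apply: measurable_funM => //; apply: measurableT_comp.
have nd x : nondecreasing_seq (fun n => (p x * nnsfun_approx measurableT mf n (phi x))%:E).
  move=> a b ab; rewrite lee_fin ler_wpM2l//.
  exact/lefP/(nd_nnsfun_approx measurableT mf).
have := @cvg_monotone_convergence _ _ _ m _ measurableT _ mg _ (fun x _ => nd x).
have -> : (\int[m]_x limn (fun n => (p x * nnsfun_approx measurableT mf n (phi x))%:E) =
    \int[m]_x (p x * f (phi x))%:E)%E.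
  apply: eq_integral => x _; apply/cvg_lim => //.
  rewrite EFinM; under eq_fun do rewrite EFinM; apply: cvgeZl => //.
  exact: (cvg_nnsfun_approx measurableT mf (fun y _ => f0 y) (x := phi x)).
apply=> n x _; rewrite lee_fin mulr_ge0//; exact: fun_ge0.
Qed.

End weighted_change_of_variables.

Section le_integral_weighted.
Context d1 d2 d' (T1 : measurableType d1) (T2 : measurableType d2)
  (Y : measurableType d') (R : realType).
Variables (m1 : {measure set T1 -> \bar R}) (p1 : T1 -> R) (phi1 : T1 -> Y).
Variables (m2 : {measure set T2 -> \bar R}) (p2 : T2 -> R) (phi2 : T2 -> Y).
Hypotheses (mp1 : measurable_fun setT p1) (p10 : forall x, 0 <= p1 x).
Hypotheses (mp2 : measurable_fun setT p2) (p20 : forall x, 0 <= p2 x).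
Hypotheses (mphi1 : measurable_fun setT phi1) (mphi2 : measurable_fun setT phi2).
Import HBNNSimple.

(** Domination on indicators extends to nonnegative functions: to simple ones by
    linearity, to the others by monotone convergence. *)
Lemma le_integral_weighted :
    (forall B, measurable B ->
      (\int[m1]_x (p1 x * \1_B (phi1 x))%:E <= \int[m2]_x (p2 x * \1_B (phi2 x))%:E)%E) ->
  forall f : Y -> R, measurable_fun setT f -> (forall y, 0 <= f y) ->
  (\int[m1]_x (p1 x * f (phi1 x))%:E <= \int[m2]_x (p2 x * f (phi2 x))%:E)%E.
Proof.
move=> le12 f /measurable_EFinP mf f0.
have c1 := cvg_integral_weighted_approx (m := m1) mp1 p10 mphi1 mf f0.
have c2 := cvg_integral_weighted_approx (m := m2) mp2 p20 mphi2 mf f0.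
rewrite -(cvg_lim _ c1)// -(cvg_lim _ c2)//; apply: lee_lim.
- by apply/cvg_ex; eexists; exact: c1.
- by apply/cvg_ex; eexists; exact: c2.
apply: nearW => n; rewrite !integral_weighted_nnsfun//.
set g := nnsfun_approx _ _ _; rewrite !fsbig_finite//=; apply: lee_sum => k _.
have [kneg|kpos] := ltP k 0; last by rewrite lee_wpmul2l ?lee_fin//; exact: le12.
by rewrite !integral0_eq ?mule0// => x _; rewrite preimage_nnfun0// indicE in_set0 mulr0.
Qed.

End le_integral_weighted.

Lemma eq_integral_weighted d1 d2 d' (T1 : measurableType d1) (T2 : measurableType d2)
  (Y : measurableType d') (R : realType)
  (m1 : {measure set T1 -> \bar R}) (p1 : T1 -> R) (phi1 : T1 -> Y)
  (m2 : {measure set T2 -> \bar R}) (p2 : T2 -> R) (phi2 : T2 -> Y) :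
    measurable_fun setT p1 -> (forall x, 0 <= p1 x) ->
    measurable_fun setT p2 -> (forall x, 0 <= p2 x) ->
    measurable_fun setT phi1 -> measurable_fun setT phi2 ->
    (forall B, measurable B ->
      (\int[m1]_x (p1 x * \1_B (phi1 x))%:E = \int[m2]_x (p2 x * \1_B (phi2 x))%:E)%E) ->
  forall f : Y -> R, measurable_fun setT f -> (forall y, 0 <= f y) ->
  (\int[m1]_x (p1 x * f (phi1 x))%:E = \int[m2]_x (p2 x * f (phi2 x))%:E)%E.
Proof.
move=> mp1 p10 mp2 p20 mphi1 mphi2 e12 f mf f0.
by apply/eqP; rewrite eq_le; apply/andP; split;
  apply: le_integral_weighted => // B mB; rewrite e12.
Qed.

Lemma measurable_cos d (T : measurableType d) (R : realType) (D : set T) (f : T -> R) :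
  measurable_fun D f -> measurable_fun D (fun x => cos (f x)).
Proof.
apply: measurableT_comp; apply: continuous_measurable_fun; exact: continuous_cos.
Qed.

Lemma measurable_sin d (T : measurableType d) (R : realType) (D : set T) (f : T -> R) :
  measurable_fun D f -> measurable_fun D (fun x => sin (f x)).
Proof.
apply: measurableT_comp; apply: continuous_measurable_fun; exact: continuous_sin.
Qed.

Lemma normr_indic_le1 (R : realType) (T : Type) (A : set T) (x : T) :
  `|\1_A x| <= 1 :> R.
Proof. by rewrite indicE; case: (_ \in _); rewrite ?normr1 ?normr0. Qed.

Lemma integrable_of_bounded d (T : measurableType d) (R : realType)
    (mu : {finite_measure set T -> \bar R}) (f : T -> R) (M : R) :
    measurable_fun setT f -> (forall x, `|f x| <= M) ->
  mu.-integrable setT (EFin \o f).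
Proof.
move=> mf fM; apply: measurable_bounded_integrable => //.
  by rewrite -ge0_fin_numE// fin_num_measure.
exists M; split; first exact: num_real.
by move=> y My x _ /=; rewrite (le_trans (fM x))// ltW.
Qed.

Lemma Rintegral_prob_cst d (T : measurableType d) (R : realType)
  (P : probability T R) (r : R) : \int[P]_x r = r.
Proof. by rewrite Rintegral_cst//= probability_setT mulr1. Qed.

Lemma Rintegral_indic_prob d (T : measurableType d) (R : realType) (P : probability T R)
  (A : set T) : measurable A -> \int[P]_x (\1_A x) = fine (P A).
Proof. by move=> mA; rewrite /Rintegral integral_indic// setIT. Qed.

Section bounded_decoupling.
Context d d' (T : measurableType d) (Y : measurableType d') (R : realType)
  (P : probability T R).
Variables (W : T -> R) (M : R) (phi : T -> Y).
Hypotheses (mW : measurable_fun setT W) (WM : forall x, `|W x| <= M).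
Hypothesis mphi : measurable_fun setT phi.

(** If the bounded variable W is uncorrelated with every indicator of phi, it is
    uncorrelated with every bounded function of phi. After adding constants W and
    f are nonnegative, and the measures W dP and (E W) dP have the same image
    under phi by [eq_integral_weighted]. *)
Lemma Rintegral_decouple (f : Y -> R) (L : R) :
    (forall B, measurable B -> \int[P]_x (W x * \1_B (phi x)) =
       (\int[P]_x W x) * \int[P]_x (\1_B (phi x))) ->
    measurable_fun setT f -> (forall y, `|f y| <= L) ->
  \int[P]_x (W x * f (phi x)) = (\int[P]_x W x) * \int[P]_x (f (phi x)).
Proof.
move=> dec mf fL.
pose c := \int[P]_x W x.
have iW : P.-integrable setT (EFin \o W) by exact: (integrable_of_bounded _ (M := M)).
have icst (r : R) : P.-integrable setT (EFin \o cst r).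
  by apply: (integrable_of_bounded _ (M := `|r|)).
have mcomp (g : Y -> R) : measurable_fun setT g -> measurable_fun setT (g \o phi).
  by move=> mg; exact: measurableT_comp.
have ig (g : Y -> R) (K : R) : measurable_fun setT g -> (forall y, `|g y| <= K) ->
    P.-integrable setT (EFin \o (g \o phi)).
  by move=> mg gK; apply: (integrable_of_bounded _ (M := K)); [exact: mcomp|move=> x; exact: gK].
have iWg (g : Y -> R) (K : R) : measurable_fun setT g -> (forall y, `|g y| <= K) ->
    P.-integrable setT (EFin \o (fun x => W x * g (phi x))).
  move=> mg gK; apply: (integrable_of_bounded _ (M := M * K)).
    by apply: measurable_funM => //; exact: mcomp.
  by move=> x; rewrite normrM ler_pM.
have M0 x : 0 <= W x + M.
  by have := WM x; rewrite ler_norml => /andP[]; lra.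
have L0 y : 0 <= f y + L.
  by have := fL y; rewrite ler_norml => /andP[]; lra.
have expand (g : Y -> R) (K : R) : measurable_fun setT g -> (forall y, `|g y| <= K) ->
  \int[P]_x ((W x + M) * g (phi x)) =
    \int[P]_x (W x * g (phi x)) + M * \int[P]_x g (phi x).
  move=> mg gK; under eq_Rintegral do rewrite mulrDl.
  rewrite RintegralD//; [|exact: iWg|].
    by rewrite RintegralZl//; exact: ig.
  rewrite (_ : _ \o _ = fun x => (M%:E * (EFin \o (g \o phi)) x)%E)//.
  by apply: integrableZl => //; exact: ig.
have cM0 : 0 <= c + M.
  rewrite -(Rintegral_prob_cst P M) -RintegralD//; last exact: icst.
  exact: Rintegral_ge0.
have indb (B : set Y) y : `|\1_B y| <= 1 :> R by exact: normr_indic_le1.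
have fin (g : T -> R) : P.-integrable setT (EFin \o g) ->
    (\int[P]_x (g x)%:E)%E = (\int[P]_x g x)%:E.
  by move=> h; rewrite fineK//; exact: integrable_fin_num.
(* the shifts by M and L make both factors nonnegative *)
have key : \int[P]_x ((W x + M) * (f (phi x) + L)) =
    \int[P]_x ((c + M) * (f (phi x) + L)).
  congr fine.
  apply: (@eq_integral_weighted _ _ _ T T Y R P (fun x => W x + M) phi P (cst (c + M)) phi
    _ _ _ _ _ _ _ (fun y => f y + L)) => //.
  - by apply: measurable_funD.
  - move=> B mB /=.
    have mB1 : measurable_fun setT (\1_B : Y -> R) by [].
    rewrite !fin; [|exact: integrableZl (ig _ _ mB1 (indb B))|].
      congr EFin; rewrite (expand _ _ mB1 (indb B)) dec// RintegralZl//; last first.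
        exact: (ig _ _ mB1 (indb B)).
      by rewrite mulrDl.
    apply: (integrable_of_bounded _ (M := (M + M) * 1)).
      by apply: measurable_funM; [exact: measurable_funD|exact: mcomp].
    move=> x; rewrite normrM ler_pM// ger0_norm// lerD2r.
    exact: le_trans (ler_norm _) (WM _).
  - exact: measurable_funD.
have fLL y : `|f y + L| <= L + L.
  by rewrite ger0_norm// lerD2r (le_trans (ler_norm _)).
have mfL : measurable_fun setT (fun y => f y + L) by exact: measurable_funD.
have e1 : \int[P]_x (W x * (f (phi x) + L)) = \int[P]_x (W x * f (phi x)) + c * L.
  under eq_Rintegral do rewrite mulrDr.
  rewrite RintegralD ?RintegralZr//; first exact: (iWg _ _ mf fL).
  by apply: (iWg (cst L) `|L|) => // y; exact: lexx.
have e2 : \int[P]_x (f (phi x) + L) = \int[P]_x f (phi x) + L.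
  by rewrite RintegralD ?Rintegral_prob_cst//; [exact: (ig _ _ mf fL)|exact: icst].
move: key; rewrite (expand (fun y => f y + L) _ mfL fLL).
rewrite RintegralZl//; last exact: (ig _ _ mfL fLL).
rewrite e1 e2 -/c; set I1 := Rintegral _ _ _; set I2 := Rintegral _ _ _ => key.
by apply: (addIr (c * L + M * (I2 + L))); rewrite addrA key; ring.
Qed.

End bounded_decoupling.

(** * Cosine transform of a sum of independent variables *)

(** Independence is given by a product rule for events, while the addition formula
    of the cosine calls for a product rule for functions. The variables are passed
    one at a time from the events to the sum: the induction on k evaluates
    E [cos(t S_k + a) ; C] for an event C on the variables of index at least k,
    and [Rintegral_decouple] turns the event on X_k into a function of X_k. The
    phase a makes sine and cosine instances of the same statement. *)
Section cos_of_independent_sum.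
Context (R : realType) d (T : measurableType d) (P : probability T R) (N : nat).
Variables (X : 'I_N -> {RV P >-> R}) (t c : R).
Hypotheses (indX : independent_rvs X).
Hypotheses (cosX : forall i, \int[P]_x cos (t * X i x) = c)
           (sinX : forall i, \int[P]_x sin (t * X i x) = 0).

Let S k x := \sum_(i < N | (i < k)%N) X i x.
Let C (J : {set 'I_N}) (B : 'I_N -> set R) := \bigcap_(i in [set` J]) X i @^-1` B i.

Let mS k : measurable_fun setT (S k).
Proof.
rewrite /S; under eq_fun do rewrite big_mkcond/=.
by apply: measurable_sum => i; case: (i < k)%N.
Qed.

Let mC J B : (forall i, measurable (B i)) -> measurable (C J B).
Proof.
move=> mB; apply: fin_bigcap_measurable => // i _.
by rewrite -[X in measurable X]setTI; exact: measurable_funP.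
Qed.

Let Rintegral_cos_partial_sum k a (J : {set 'I_N}) (B : 'I_N -> set R) :
    (k <= N)%N -> (forall i, measurable (B i)) ->
    (forall i, i \in J -> (k <= i)%N) ->
  \int[P]_x (cos (t * S k x + a) * \1_(C J B) x) = c ^+ k * cos a * fine (P (C J B)).
Proof.
elim: k a J B => [|k IH] a J B kN mB kJ.
  rewrite expr0 mul1r -Rintegral_indic_prob; last exact: mC.
  rewrite -RintegralZl//; last first.
    apply: (integrable_of_bounded _ (M := 1)); last exact: normr_indic_le1.
    by apply: measurable_indic; exact: mC.
  by apply: eq_Rintegral => x _; rewrite /S big_pred0// mulr0 add0r.
pose i0 := Ordinal kN.
have i0J : i0 \notin J by apply/negP => /kJ; rewrite ltnn.
have SS x : S k.+1 x = S k x + X i0 x.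
  rewrite /S (bigD1 i0)//= addrC; congr (_ + _); apply: eq_bigl => i.
  by rewrite ltnS ltn_neqAle andbC.
(* the inductive hypothesis gives the integral of W b for every phase b *)
pose W b x := cos (t * S k x + b) * \1_(C J B) x.
have mW b : measurable_fun setT (W b).
  apply: measurable_funM; last by apply: measurable_indic; exact: mC.
  by apply: measurable_cos; apply: measurable_funD => //; exact: measurable_funM.
have W1 b x : `|W b x| <= 1.
  by rewrite /W normrM -[leRHS]mulr1 ler_pM// ?cos_max// normr_indic_le1.
have WE b : \int[P]_x W b x = c ^+ k * cos b * fine (P (C J B)).
  by apply: IH => //; [exact: ltnW|move=> i /kJ/ltnW].
(* an event on X i0 enlarges the family of events C J B, to which the inductive
   hypothesis applies as well *)
have dec b D : measurable D -> \int[P]_x (W b x * \1_D (X i0 x)) =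
    (\int[P]_x W b x) * \int[P]_x (\1_D (X i0 x)).
  move=> mD; pose B' i := if i == i0 then D else B i.
  have mB' i : measurable (B' i) by rewrite /B'; case: ifP.
  have CE : C (i0 |: J)%SET B' = C J B `&` X i0 @^-1` D.
    apply/seteqP; split => x /=.
      move=> h; split=> [i iJ|].
        have /= := h i; rewrite !inE /B' (negbTE (memPn i0J i iJ)) /=.
        by apply; exact: iJ.
      by have /= := h i0; rewrite !inE eqxx /B' eqxx; exact.
    move=> [h hD] i /=; rewrite !inE => /orP[/eqP ->|iJ].
      by rewrite /B' eqxx.
    rewrite /B' (negbTE (memPn i0J i iJ)); exact: h.
  have h1 : \int[P]_x (W b x * \1_D (X i0 x)) =
      \int[P]_x (cos (t * S k x + b) * \1_(C (i0 |: J)%SET B') x).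
    apply: eq_Rintegral => x _; rewrite /W -mulrA; congr (_ * _).
    by rewrite CE indicI.
  have mX0 : measurable (X i0 @^-1` D).
    by rewrite -[X in measurable X]setTI; exact: measurable_funP.
  have h2 : \int[P]_x (\1_D (X i0 x)) = fine (P (X i0 @^-1` D)).
    by rewrite -Rintegral_indic_prob.
  rewrite h1 IH//; last 2 first.
  - exact: ltnW.
  - by move=> i; rewrite !inE => /orP[/eqP ->//|/kJ/ltnW].
  have -> : P (C (i0 |: J)%SET B') = (P (X i0 @^-1` D) * P (C J B))%E.
    rewrite /C indX// (big_setU1 i0)//= indX// {1}/B' eqxx.
    congr (_ * _)%E; apply: eq_bigr => i iJ.
    by rewrite /B' (negbTE (memPn i0J i iJ)).
  rewrite h2 WE fineM ?fin_num_measure//; last exact: mC.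
  ring.
(* a phase shift by pi / 2 turns the sine of the partial sum into a cosine *)
have splitE x : cos (t * S k.+1 x + a) * \1_(C J B) x =
    W a x * cos (t * X i0 x) - W (a - pi / 2) x * sin (t * X i0 x).
  rewrite SS (_ : t * (S k x + X i0 x) + a = (t * S k x + a) + t * X i0 x); last ring.
  by rewrite cosD /W addrA cosBpihalf; ring.
under eq_Rintegral do rewrite splitE.
have mf : measurable_fun setT (fun y => cos (t * y)).
  by apply: measurable_cos; exact: measurable_funM.
have mg : measurable_fun setT (fun y => sin (t * y)).
  by apply: measurable_sin; exact: measurable_funM.
have mX0 : measurable_fun setT (X i0) by [].
have iWf b (f : R -> R) : measurable_fun setT f -> (forall y, `|f y| <= 1) ->
    P.-integrable setT (EFin \o (fun x => W b x * f (X i0 x))).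
  move=> mf' f1; apply: (integrable_of_bounded _ (M := 1 * 1)).
    by apply: measurable_funM => //; exact: measurableT_comp.
  by move=> x; rewrite normrM ler_pM.
rewrite RintegralB//; last 2 first.
- by apply: (iWf a _ mf) => y; exact: cos_max.
- by apply: (iWf _ _ mg) => y; exact: sin_max.
rewrite (Rintegral_decouple (mW _) (W1 _) mX0 (dec _) mf (L := 1))//; last first.
  by move=> y; exact: cos_max.
rewrite (Rintegral_decouple (mW _) (W1 _) mX0 (dec _) mg (L := 1))//; last first.
  by move=> y; exact: sin_max.
rewrite cosX sinX mulr0 subr0 WE exprSr; ring.
Qed.

Lemma Rintegral_cos_independent_sum a :
  \int[P]_x cos (t * (\sum_(i < N) X i x) + a) = c ^+ N * cos a.
Proof.
have := @Rintegral_cos_partial_sum N a finset.set0 (fun=> setT) (leqnn _).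
rewrite (_ : C _ _ = setT); last first.
  by rewrite /C -subTset => x _ i /=; rewrite inE.
rewrite probability_setT mulr1 => <-//; last by move=> i; rewrite inE.
apply: eq_Rintegral => x _; rewrite indicT mulr1; congr (cos (t * _ + _)).
by apply: eq_bigl => i; rewrite ltn_ord.
Qed.

End cos_of_independent_sum.

(** * Integrals over half-lines *)

Lemma is_derive_continuous (R : realType) (f f' : R -> R) :
  (forall x, is_derive x (1 : R) f (f' x)) -> continuous f.
Proof.
move=> df x; apply/differentiable_continuous/derivable1_diffP.
exact: (@ex_derive _ _ _ _ _ _ _ (df x)).
Qed.

(** The fundamental theorem of calculus on compact intervals, followed by
    dominated convergence along intervals exhausting D. *)
Lemma Rintegral_FTC_exhaust (R : realType) (f F : R -> R) (D : set R)
    (a b : nat -> R) (l : R) :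
  measurable D -> lebesgue_measure.-integrable D (EFin \o f) ->
  (forall n, a n < b n) -> (forall n, `[a n, b n] `<=` D) ->
  (forall x, D x -> \forall n \near \oo, x \in `[a n, b n]) ->
  continuous f -> (forall x, is_derive x (1 : R) F (f x)) ->
  F (b n) - F (a n) @[n --> \oo] --> l ->
  \int[lebesgue_measure]_(x in D) f x = l.
Proof.
move=> mD intf ab abD Dab cf dF Fl.
pose fn n := (EFin \o f) \_ `[a n, b n]%classic.
have fnE n : (\int[lebesgue_measure]_(x in D) fn n x = (F (b n) - F (a n))%:E)%E.
  rewrite -integral_mkcondr setIidr; last exact: abD.
  rewrite (@continuous_FTC2 _ f F)//.
  - exact: continuous_subspaceT.
  - have dF1 x : derivable F x 1 by exact: (@ex_derive _ _ _ _ _ _ _ (dF x)).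
    have cF : continuous F by exact: is_derive_continuous dF.
    split => [x _||]; first exact: dF1.
    + by apply: cvg_at_right_filter; exact: cF.
    + by apply: cvg_at_left_filter; exact: cF.
  - by move=> x _; rewrite derive1E (@derive_val _ _ _ _ _ _ _ (dF x)).
have mf : measurable_fun D (EFin \o f) by exact: measurable_int intf.
have : (\int[lebesgue_measure]_(x in D) fn n x)%E @[n --> \oo] -->
    (\int[lebesgue_measure]_(x in D) (f x)%:E)%E.
  apply: (@dominated_cvg _ _ _ lebesgue_measure D mD fn _
    (fun x => `|(f x)%:E|%E)) => //.
  - move=> n; rewrite /fn.
    apply/(measurable_restrict _ _ _).1 => //.
    by apply: measurable_funS mf => //; exact: subIsetl.
  - move=> x Dx; apply: cvg_near_cst; have := Dab x Dx.
    by apply: filterS => n xab; rewrite /fn patchE mem_set.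
  - exact: integrable_abse.
  - move=> n x Dx; rewrite /fn patchE; case: ifP => // _.
    by rewrite -[point]/(0%E : \bar R) abse0 abse_ge0.
under eq_fun do rewrite fnE.
have ifin : (\int[lebesgue_measure]_(x in D) (f x)%:E)%E \is a fin_num.
  exact: integrable_fin_num.
rewrite -(fineK ifin) => /fine_cvg h.
by apply/esym; apply: (cvg_unique _ Fl h).
Qed.

Lemma cvgy_expRNM (R : realType) (e : R) : 0 < e ->
  expR (- (e * x)) @[x --> +oo] --> (0 : R).
Proof.
move=> e0; apply: (cvg_comp (fun x => e * x) (fun x => expR (- x))); last exact: cvgr_expR.
by apply/(gt0_cvgMry e0); exact: cvg_id.
Qed.

Lemma cvg_expRMn (R : realType) (e : R) : 0 < e -> expR (- (e * n%:R)) @[n --> \oo] --> (0 : R).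
Proof.
move=> e0; apply: (cvg_comp (fun n => n%:R) (fun x => expR (- (e * x)))).
  exact: cvgr_idn.
exact: cvgy_expRNM.
Qed.

Lemma ge0_near_itv0n (R : realType) (x : R) : 0 <= x -> \forall n \near \oo, x \in `[0, n.+1%:R].
Proof.
move=> x0; apply: filterS (nbhs_infty_ger x) => n xn.
by rewrite in_itv/= x0 (le_trans xn)// ler_nat.
Qed.

Lemma integrable_expR_half (R : realType) (e : R) : 0 < e ->
  lebesgue_measure.-integrable `[0, +oo[ (EFin \o (fun t : R => expR (- (e * t)))).
Proof.
move=> e0.
have mf : measurable_fun (`[0, +oo[ : set R) (EFin \o (fun t : R => expR (- (e * t)))).
  apply/measurable_EFinP; apply: measurableT_comp => //.
  by apply: measurableT_comp => //; exact: measurable_funM.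
have d (x : R) : is_derive x (1 : R) (fun t : R => - (e^-1 * expR (- (e * t)))) (expR (- (e * x))).
  apply: is_derive_eq; rewrite /GRing.scale/=; field; exact: lt0r_neq0.
apply/integrableP; split => //.
under eq_integral do rewrite /= ger0_norm ?expR_ge0//.
rewrite (@ge0_continuous_FTC2y _ (fun t => expR (- (e * t))) (fun t => - (e^-1 * expR (- (e * t)))) 0 0).
- by rewrite -EFinB ltry.
- by move=> x _; exact: expR_ge0.
- apply: derivable_within_continuous => x _; exact: ex_derive.
- rewrite -oppr0; apply: cvgN; rewrite -(mulr0 e^-1); apply: cvgMl_tmp.
  exact: cvgy_expRNM.
- by move=> x _; exact: ex_derive.
- by apply: cvg_at_right_filter; exact: (is_derive_continuous d).
- by move=> x _; rewrite derive1E derive_val.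
Qed.

Lemma Rintegral_expR_half (R : realType) (e : R) : 0 < e ->
  \int[lebesgue_measure]_(t in `[0, +oo[) expR (- (e * t)) = e^-1.
Proof.
move=> e0.
have d (x : R) : is_derive x (1 : R) (fun t : R => - (e^-1 * expR (- (e * t)))) (expR (- (e * x))).
  apply: is_derive_eq; rewrite /GRing.scale/=; field; exact: lt0r_neq0.
apply: (Rintegral_FTC_exhaust (a := fun=> 0) (b := fun n => n.+1%:R) _ _ _ _ _ _ d) => //.
- exact: integrable_expR_half.
- by move=> n x /=; rewrite !in_itv/= => /andP[->].
- by move=> x /=; rewrite in_itv/= andbT; exact: ge0_near_itv0n.
- by move=> x; apply: differentiable_continuous; apply/derivable1_diffP; exact: ex_derive.
rewrite mulr0 oppr0 expR0 mulr1 opprK -[X in _ --> X]add0r; apply: cvgD; last exact: cvg_cst.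
rewrite -oppr0; apply: cvgN; rewrite -(mulr0 e^-1); apply: cvgMl_tmp.
by rewrite (cvg_shiftS (fun n => expR (- (e * n%:R)))); exact: cvg_expRMn.
Qed.

(** An antiderivative is exp(- e t) (y sin(t y) - e cos(t y)) / (e^2 + y^2). *)
Lemma Rintegral_expR_cos (R : realType) (e y : R) : 0 < e ->
  \int[lebesgue_measure]_(t in `[0, +oo[) (expR (- (e * t)) * cos (t * y)) = e / (e ^+ 2 + y ^+ 2).
Proof.
move=> e0.
have e2y2 : 0 < e ^+ 2 + y ^+ 2 by rewrite ltr_wpDr ?sqr_ge0// exprn_gt0.
have d (x : R) : is_derive x (1 : R)
   (fun t : R => expR (- (e * t)) * ((y * sin (t * y) - e * cos (t * y)) / (e ^+ 2 + y ^+ 2)))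
   (expR (- (e * x)) * cos (x * y)).
  apply: is_derive_eq; rewrite /GRing.scale/=; field; exact: lt0r_neq0.
apply: (Rintegral_FTC_exhaust (a := fun=> 0) (b := fun n => n.+1%:R) _ _ _ _ _ _ d) => //.
- apply: le_integrable (integrable_expR_half e0) => //.
    apply/measurable_EFinP; apply: measurable_funM.
      apply: measurableT_comp => //.
      by apply: measurableT_comp => //; exact: measurable_funM.
    by apply: measurable_cos; exact: measurable_funM.
  move=> x _; rewrite lee_fin normrM ler_piMr//; exact: cos_max.
- by move=> n x /=; rewrite !in_itv/= => /andP[->].
- by move=> x /=; rewrite in_itv/= andbT; exact: ge0_near_itv0n.
- by move=> x; apply: differentiable_continuous; apply/derivable1_diffP; exact: ex_derive.
rewrite mulr0 oppr0 expR0 mul0r sin0 cos0 mulr0 mulr1 mul1r sub0r mulNr opprK -[X in _ --> X]add0r.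
apply: cvgD; last exact: cvg_cst.
pose K := (`|y| + e) / (e ^+ 2 + y ^+ 2).
apply: norm_cvg0; apply: (@squeeze_cvgr _ _ _ _ (cst 0) (fun n => expR (- (e * n.+1%:R)) * K)).
- apply: nearW => n; rewrite normr_ge0/= normrM (ger0_norm (expR_ge0 _)) ler_wpM2l ?expR_ge0//.
  rewrite /K normrM [X in _ * X]gtr0_norm ?invr_gt0// ler_wpM2r ?invr_ge0 ?(ltW e2y2)//.
  rewrite (le_trans (ler_normB _ _))// !normrM lerD// ?ler_piMr ?sin_max ?cos_max//.
  by rewrite (gtr0_norm e0) ler_piMr ?cos_max// ltW.
- exact: cvg_cst.
- rewrite -(mul0r K); apply: cvgMr_tmp.
  by rewrite (cvg_shiftS (fun n => expR (- (e * n%:R)))); exact: cvg_expRMn.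
Qed.

(** The integrand is the derivative of - 4 exp(- t^2/8). *)
Lemma integral_xexpR_sqr (R : realType) :
  lebesgue_measure.-integrable (`]0, +oo[%classic : set R)
    (EFin \o (fun t : R => t * expR (- (t ^+ 2 / 8)))) /\
  \int[lebesgue_measure]_(t in (`]0, +oo[%classic : set R)) (t * expR (- (t ^+ 2 / 8))) = 4.
Proof.
have d (x : R) : is_derive x (1 : R) (fun t : R => - (4 * expR (- (t ^+ 2 / 8)))) (x * expR (- (x ^+ 2 / 8))).
  by apply: is_derive_eq; rewrite /GRing.scale/=; field.
have dd (x : R) : is_derive x (1 : R) (fun t : R => t * expR (- (t ^+ 2 / 8)))
    (expR (- (x ^+ 2 / 8)) - x * (x / 4) * expR (- (x ^+ 2 / 8))).
  by apply: is_derive_eq; rewrite /GRing.scale/=; field.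
have cf := is_derive_continuous dd.
have mf : measurable_fun setT (fun t : R => t * expR (- (t ^+ 2 / 8))).
  exact: continuous_measurable_fun.
have key : (\int[lebesgue_measure]_(t in `[0%R, +oo[) (t * expR (- (t ^+ 2 / 8)))%:E = (4 : R)%:E)%E.
  rewrite (@ge0_continuous_FTC2y _ _ (fun t => - (4 * expR (- (t ^+ 2 / 8)))) 0 0).
  - by rewrite -EFinB; congr EFin; rewrite expr0n/= mul0r oppr0 expR0 mulr1 opprK add0r.
  - by move=> x x0; rewrite mulr_ge0// expR_ge0.
  - exact: continuous_subspaceT.
  - rewrite -oppr0; apply: cvgN; rewrite -(mulr0 4); apply: cvgMl_tmp.
    apply: (cvg_comp (fun x : R => x ^+ 2) (fun x => expR (- (x / 8)))); first exact: cvgr_expr2.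
    under eq_fun do rewrite mulrC.
    exact: cvgy_expRNM.
  - by move=> x _; exact: (@ex_derive _ _ _ _ _ _ _ (d x)).
  - by apply: cvg_at_right_filter; exact: (is_derive_continuous d).
  - by move=> x _; rewrite derive1E (@derive_val _ _ _ _ _ _ _ (d x)).
have key' : (\int[lebesgue_measure]_(t in `]0%R, +oo[) (t * expR (- (t ^+ 2 / 8)))%:E = (4 : R)%:E)%E.
  rewrite integral_itv_obnd_cbnd//; apply/measurable_EFinP; exact: measurable_funTS.
split; last by rewrite /Rintegral key'.
apply/integrableP; split; first by apply/measurable_EFinP; exact: measurable_funTS.
have -> : (\int[lebesgue_measure]_(t in `]0%R, +oo[) `|(EFin \o (fun t : R => t * expR (- (t ^+ 2 / 8)))%R) t| =
    \int[lebesgue_measure]_(t in `]0%R, +oo[) (t * expR (- (t ^+ 2 / 8)))%:E)%E.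
  apply: eq_integral => t; rewrite inE/= in_itv/= andbT => t0.
  by rewrite ger0_norm// mulr_ge0 ?expR_ge0// ltW.
by rewrite key' ltry.
Qed.

(** * Cosine transform of the standard normal law *)

(** The product of f with exp(t^2/2) has zero derivative. *)
Lemma gaussian_ode (R : realType) (f : R -> R) :
  (forall t, is_derive t (1 : R) f (- t * f t)) ->
  forall t, f t = f 0 * expR (- (t ^+ 2 / 2)).
Proof.
move=> df t.
have d (s : R) : is_derive s (1 : R) (fun s => f s * expR (s ^+ 2 / 2)) 0.
  have dfs := df s.
  by apply: is_derive_eq; rewrite /GRing.scale/=; field.
have /= := is_derive_0_is_cst t 0 d.
rewrite expr0n/= mul0r expR0 mulr1 => <-.
by rewrite -mulrA -expRD subrr expR0 mulr1.
Qed.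

Section standard_normal.
Variable R : realType.
Notation leb := (@lebesgue_measure R).
Notation p := (@normal_pdf R 0 1).

Let pE x : p x = normal_peak 1 * expR (- (x ^+ 2 / 2)).
Proof. by rewrite normal_pdfE// /normal_fun subr0 expr1n mulNr -(mulr_natr 1) mul1r. Qed.

Let p0 x : 0 <= p x.
Proof. exact: normal_pdf_ge0. Qed.

Let mp : measurable_fun setT p.
Proof. exact: measurable_normal_pdf. Qed.

Let ip : leb.-integrable setT (EFin \o p).
Proof. exact: integrable_normal_pdf. Qed.

Let intp : \int[leb]_x p x = 1.
Proof. by rewrite /Rintegral integral_normal_pdf. Qed.

(** The normal density is at most 1 / sqrt (2 pi), and pi >= 2. *)
Lemma normal_peak1_le_half : normal_peak (1 : R) <= 1 / 2.
Proof.
rewrite /normal_peak expr1n mul1r -mulr_natr div1r lef_pV2 ?posrE ?sqrtr_gt0//.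
  rewrite -[leLHS]ger0_norm// -sqrtr_sqr ler_wsqrtr//.
  by rewrite expr2 ler_wpM2r// pi_ge2.
by rewrite mulr_gt0// pi_gt0.
Qed.

Lemma ge0_integral_normal_prob01 (f : R -> R) :
    measurable_fun setT f -> (forall x, 0 <= f x) ->
  (\int[normal_prob 0 1]_x (f x)%:E = \int[leb]_x (p x * f x)%:E)%E.
Proof.
move=> mf f0.
have := @eq_integral_weighted _ _ _ _ _ _ R (normal_prob 0 1) (cst 1) id leb p id
  _ _ mp p0 _ _ _ f mf f0.
under eq_integral do rewrite mul1r.
apply=> //= B mB.
under eq_integral do rewrite mul1r.
transitivity (\int[leb]_(x in B) (p x)%:E)%E; first by rewrite integral_indic// setIT.
rewrite [LHS]integral_mkcond.
by apply: eq_integral => x _; rewrite patchE indicE; case: ifP; rewrite ?mulr1 ?mulr0.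
Qed.

Lemma Rintegral_normal_prob01 (f : R -> R) (M : R) :
    measurable_fun setT f -> (forall x, `|f x| <= M) ->
  \int[normal_prob 0 1]_x f x = \int[leb]_x (p x * f x).
Proof.
move=> mf fM.
have f0 x : 0 <= f x + M by have := fM x; rewrite ler_norml => /andP[]; lra.
have mfM : measurable_fun setT (fun x => f x + M) by exact: measurable_funD.
have := congr1 fine (ge0_integral_normal_prob01 mfM f0).
have icst : (normal_prob (0:R) 1).-integrable setT (EFin \o cst M).
  by apply: (integrable_of_bounded _ (M := `|M|)).
have -> : fine (\int[normal_prob 0 1]_x (f x + M)%:E) = \int[normal_prob 0 1]_x f x + M.
  rewrite -[fine _]/(Rintegral _ _ _) RintegralD ?Rintegral_prob_cst//.
  exact: (integrable_of_bounded _ (M := M)).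
have -> : fine (\int[leb]_x (p x * (f x + M))%:E) = \int[leb]_x (p x * f x) + M.
  rewrite -[fine _]/(Rintegral _ _ _); under eq_Rintegral do rewrite mulrDr.
  rewrite RintegralD//.
  - by rewrite RintegralZr// intp mul1r.
  - apply: le_integrable (integrableZl measurableT M ip) => //.
      by apply/measurable_EFinP; exact: measurable_funM.
    move=> x _; rewrite /= lee_fin mulrC !normrM ler_wpM2r//.
    by rewrite (le_trans (fM x))// ler_norm.
  - rewrite (_ : _ \o _ = fun x => (M%:E * (p x)%:E)%E); first exact: integrableZl.
    by apply/funext => x /=; rewrite -EFinM mulrC.
by move/addIr.
Qed.

(** Up to a constant, p x * |x| is below the normal density of variance 2, since
    |x| <= 1 + x^2/4 <= exp(x^2/4). *)
Let integrable_normp : leb.-integrable setT (EFin \o (fun x => p x * `|x|)).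
Proof.
have s2 : Num.sqrt 2 != 0 :> R by rewrite sqrtr_eq0 -ltNge.
have := integrable_normal_pdf 0 (Num.sqrt 2 : R).
move/(integrableZl measurableT (normal_peak 1 / normal_peak (Num.sqrt 2))).
apply: le_integrable => //.
  by apply/measurable_EFinP; apply: measurable_funM => //; exact: (@normr_measurable R setT).
move=> x _; rewrite /= lee_fin ger0_norm ?mulr_ge0//.
apply: le_trans (ler_norm _).
rewrite [in leRHS]normal_pdfE// /normal_fun subr0 mulrA divfK; last by rewrite gt_eqF ?normal_peak_gt0.
rewrite pE -mulrA ler_wpM2l ?normal_peak_ge0// sqr_sqrtr//.
have -> : - (x ^+ 2 / 2) = - x ^+ 2 / (2 *+ 2) - x ^+ 2 / 4 by rewrite -mulr_natr; field.
rewrite expRD -[leRHS]mulr1 -mulrA ler_wpM2l ?expR_ge0//.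
rewrite expRN ler_pdivrMl ?expR_gt0// mulr1.
apply: le_trans (expR_ge1Dx _).
have -> : x ^+ 2 = `|x| ^+ 2 by rewrite real_normK ?num_real.
have aux (y : R) : y <= 1 + y ^+ 2 / 4 by have := sqr_ge0 (y / 2 - 1); lra.
exact: aux.
Qed.

Lemma integral_normal_prob01_normr_lty : (\int[normal_prob (0:R) 1]_x `|x|%:E < +oo)%E.
Proof.
rewrite ge0_integral_normal_prob01//.
have /integrableP[_] := integrable_normp.
by under eq_integral do rewrite /= ger0_norm ?mulr_ge0//.
Qed.

Let dp (x : R) : is_derive x (1 : R) p (- x * p x).
Proof.
rewrite (_ : p = fun x => normal_peak 1 * expR (- (x ^+ 2 / 2))); last exact/funext.
by apply: is_derive_eq; rewrite /GRing.scale/=; field.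
Qed.

Let mcos (t a : R) : measurable_fun setT (fun x : R => cos (t * x + a)).
Proof. by apply: measurable_cos; apply: measurable_funD => //; exact: measurable_funM. Qed.

Let msin (t a : R) : measurable_fun setT (fun x : R => sin (t * x + a)).
Proof. by apply: measurable_sin; apply: measurable_funD => //; exact: measurable_funM. Qed.

Let ipcos (t a : R) : leb.-integrable setT (EFin \o (fun x => p x * cos (t * x + a))).
Proof.
apply: le_integrable ip => //.
  by apply/measurable_EFinP; exact: (measurable_funM mp (mcos t a)).
by move=> x _; rewrite lee_fin normrM ler_piMr// cos_max.
Qed.

Let ipxsin (t a : R) : leb.-integrable setT (EFin \o (fun x => p x * x * sin (t * x + a))).
Proof.
apply: le_integrable integrable_normp => //.
  apply/measurable_EFinP; apply: measurable_funM; last exact: (msin t a).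
  by apply: measurable_funM => //; exact: mp.
by move=> x _; rewrite lee_fin !normrM normr_id ler_piMr// ?mulr_ge0// sin_max.
Qed.

(** Integration by parts: x p(x) is the opposite of the derivative of p. *)
Let parts (t a : R) :
  \int[leb]_x (p x * x * sin (t * x + a)) = t * \int[leb]_x (p x * cos (t * x + a)).
Proof.
have iZ : leb.-integrable setT (EFin \o (fun x => t * (p x * cos (t * x + a)))).
  exact: (integrableZl measurableT t (ipcos t a)).
rewrite -RintegralZl//; apply/eqP; rewrite -subr_eq0 -RintegralB//.
have d (x : R) : is_derive x (1 : R) (fun x => - (p x * sin (t * x + a)))
    (p x * x * sin (t * x + a) - t * (p x * cos (t * x + a))).
  have dpx := dp x.
  by apply: is_derive_eq; rewrite /GRing.scale/=; ring.
apply/eqP; apply: (Rintegral_FTC_exhaust (a := fun n => - n.+1%:R) (b := fun n => n.+1%:R) _ _ _ _ _ _ d) => //.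
- exact: (integrableB measurableT (ipxsin t a) iZ).
- by move=> n; rewrite gtrN.
- move=> x _; apply: filterS (nbhs_infty_ger `|x|) => n xn.
  by rewrite in_itv/= -ler_norml (le_trans xn)// ler_nat.
- have cp := is_derive_continuous dp.
  have cc : continuous (fun x : R => cos (t * x + a)).
    apply: (is_derive_continuous (f' := fun x => - sin (t * x + a) * t)) => x.
    by apply: is_derive_eq; rewrite /GRing.scale/=; ring.
  have cs : continuous (fun x : R => sin (t * x + a)).
    apply: (is_derive_continuous (f' := fun x => cos (t * x + a) * t)) => x.
    by apply: is_derive_eq; rewrite /GRing.scale/=; ring.
  move=> x; apply: cvgB; first by apply: cvgM; [apply: cvgM; [exact: cp|exact: cvg_id]|exact: cs].
  by apply: cvgM; [exact: cvg_cst|apply: cvgM; [exact: cp|exact: cc]].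
have lim0 (u : nat -> R) : (forall n, `|u n| = n.+1%:R) ->
    - (p (u n) * sin (t * u n + a)) @[n --> \oo] --> (0 : R).
  move=> un; apply: norm_cvg0.
  apply: (@squeeze_cvgr _ _ _ _ (cst 0) (fun n => normal_peak 1 * expR (- (1 / 2 * n.+1%:R)))).
  - apply: nearW => n; rewrite normr_ge0/= normrN normrM (ger0_norm (p0 _)).
    rewrite (le_trans (y := p (u n))) ?ler_piMr ?sin_max// pE ler_wpM2l ?normal_peak_ge0//.
    rewrite ler_expR lerN2; have : u n ^+ 2 = n.+1%:R ^+ 2.
      by rewrite -(un n) real_normK ?num_real.
    have : 1 <= n.+1%:R :> R by rewrite ler1n.
    nra.
  - exact: cvg_cst.
  - rewrite -(mulr0 (normal_peak 1)); apply: cvgMl_tmp.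
    by rewrite (cvg_shiftS (fun n => expR (- (1 / 2 * n%:R)))); exact: cvg_expRMn.
have l1 := lim0 (fun n => n.+1%:R) (fun n => ger0_norm (ler0n R n.+1)).
have l2 := lim0 (fun n => - n.+1%:R) (fun n => etrans (normrN _) (ger0_norm (ler0n R n.+1))).
rewrite -[X in _ --> X](subr0 (0 : R)); exact: (cvgB l1 l2).
Qed.

Let h (a t : R) := \int[leb]_x (p x * cos (t * x + a)).

Let dh (a t : R) : is_derive t (1 : R) (h a) (- t * h a t).
Proof.
have d1 (s x : R) : is_derive s (1 : R) (fun s => p x * cos (s * x + a))
    (- (p x * x * sin (s * x + a))).
  by apply: is_derive_eq; rewrite /GRing.scale/=; ring.
have dE s x : (partial1of2 (fun s x => p x * cos (s * x + a))) s x = - (p x * x * sin (s * x + a)).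
  by rewrite partial1of2E; exact: (@derive_val _ _ _ _ _ _ _ (d1 s x)).
have hyp := (@derivable_under_integral R _ _ leb (fun s x => p x * cos (s * x + a)) setT measurableT
  t (t - 1) (t + 1) _ _ _ (fun x => p x * `|x|) _ integrable_normp _).
have hyp' := (@differentiation_under_integral R _ _ leb (fun s x => p x * cos (s * x + a)) setT measurableT
  t (t - 1) (t + 1) _ _ _ (fun x => p x * `|x|) _ integrable_normp _).
apply: DeriveDef.
- apply: hyp.
  + by rewrite /= in_itv/=; apply/andP; split; lra.
  + by move=> s _; exact: ipcos.
  + by move=> s x _ _; exact: (@ex_derive _ _ _ _ _ _ _ (d1 s x)).
  + by move=> x; exact: mulr_ge0.
  + move=> s x _ _; rewrite dE normrN !normrM (ger0_norm (p0 x)) ler_piMr ?sin_max// mulr_ge0//.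
- rewrite -derive1E hyp'.
  + rewrite mulNr -parts.
    under eq_Rintegral do rewrite dE -mulN1r.
    by rewrite RintegralZl ?mulN1r//; exact: ipxsin.
  + by rewrite /= in_itv/=; apply/andP; split; lra.
  + by move=> s _; exact: ipcos.
  + by move=> s x _ _; exact: (@ex_derive _ _ _ _ _ _ _ (d1 s x)).
  + by move=> x; exact: mulr_ge0.
  + move=> s x _ _; rewrite dE normrN !normrM (ger0_norm (p0 x)) ler_piMr ?sin_max// mulr_ge0//.
Qed.

(** Differentiating under the integral sign and integrating by parts shows that
    the left-hand side, as a function of t, solves y' = - t y. *)
Lemma Rintegral_normal_prob01_cos (t a : R) :
  \int[normal_prob 0 1]_x cos (t * x + a) = expR (- (t ^+ 2 / 2)) * cos a.
Proof.
rewrite (@Rintegral_normal_prob01 _ 1)//; last by move=> x; exact: cos_max.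
rewrite -/(h a t).
have h0 : h a 0 = cos a.
  rewrite /h; under eq_Rintegral do rewrite mul0r add0r.
  by rewrite RintegralZr// intp mul1r.
by rewrite (gaussian_ode (dh a)) h0 mulrC.
Qed.

End standard_normal.

(** * Fourier inversion of a Cauchy-smoothed distribution function *)

(** Inversion is discontinuous at 0, where its value is 0; writing the inverse of
    x as x times the power -1 of x^2 avoids a case distinction. *)
Lemma measurable_invr (R : realType) : measurable_fun setT (@GRing.inv R).
Proof.
rewrite (_ : GRing.inv = fun x : R => x * (x ^+ 2) `^ (-1)).
  apply: measurable_funM => //.
  by apply: (measurableT_comp (f := fun x : R => x `^ (-1))) => //; exact: measurable_powR.
apply/funext => x; rewrite powR_inv1 ?sqr_ge0//.
have [->|x0] := eqVneq x 0; first by rewrite invr0 mul0r.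
by field.
Qed.

Section atan_fourier.
Variables (R : realType) (e : R).
Hypothesis e0 : 0 < e.
Notation leb := (@lebesgue_measure R).
Notation D := (`]0, +oo[%classic : set R).

Lemma integrable_expR_oy : leb.-integrable D (EFin \o (fun t : R => expR (- (e * t)))).
Proof.
apply: integrableS (integrable_expR_half e0) => //.
by apply: subset_itvr; rewrite bnd_simp.
Qed.

Lemma Rintegral_expR_oy : \int[leb]_(t in D) expR (- (e * t)) = e^-1.
Proof.
rewrite Rintegral_itv_obnd_cbnd ?Rintegral_expR_half//; exact: integrable_expR_oy.
Qed.

Lemma normr_sinc_le (t x : R) : 0 < t -> `|sin (t * x) / t| <= `|x|.
Proof.
move=> t0; rewrite normrM [X in _ * X]gtr0_norm ?invr_gt0// ler_pdivrMr//.
by rewrite (le_trans (normr_sin_le _))// normrM (gtr0_norm t0) mulrC.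
Qed.

Let msinc (x : R) : measurable_fun setT (fun t : R => sin (t * x) / t).
Proof.
apply: measurable_funM; first by apply: measurable_sin; exact: measurable_funM.
by apply: (measurableT_comp (@measurable_invr R)).
Qed.

Let mexp : measurable_fun setT (fun t : R => expR (- (e * t))).
Proof. by apply: measurableT_comp => //; apply: measurableT_comp => //; exact: measurable_funM. Qed.

Let int_sinc (s : R) :
  leb.-integrable D (EFin \o (fun t => expR (- (e * t)) * (sin (t * s) / t))).
Proof.
have h : leb.-integrable D (fun t => `|s|%:E * (expR (- (e * t)))%:E)%E.
  by apply: integrableZl => //; exact: integrable_expR_oy.
apply: (le_integrable _ _ _ h) => //.
  by apply/measurable_EFinP; apply: measurable_funTS; exact: (measurable_funM mexp (msinc s)).
move=> t /=; rewrite in_itv/= andbT => t0.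
rewrite lee_fin !normrM normr_id (ger0_norm (expR_ge0 _)) mulrC ler_wpM2r ?expR_ge0//.
by rewrite -normrM normr_sinc_le.
Qed.

(** Both sides vanish at x = 0 and have derivative e / (e^2 + x^2), by
    differentiation under the integral sign and [Rintegral_expR_cos]. *)
Lemma Rintegral_expR_sinc (x : R) :
  \int[leb]_(t in D) (expR (- (e * t)) * (sin (t * x) / t)) = atan (x / e).
Proof.
pose f s t := expR (- (e * t)) * (sin (t * s) / t).
have d1 (s t : R) : 0 < t -> is_derive s (1 : R) (f ^~ t) (expR (- (e * t)) * cos (t * s)).
  move=> t0; rewrite /f; apply: is_derive_eq; rewrite /GRing.scale/=; field.
  exact: lt0r_neq0.
have dE s t : 0 < t -> (partial1of2 f) s t = expR (- (e * t)) * cos (t * s).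
  by move=> t0; rewrite partial1of2E; exact: (@derive_val _ _ _ _ _ _ _ (d1 s t t0)).
have bnd (s t : R) : D t -> `|(partial1of2 f) s t| <= expR (- (e * t)).
  rewrite /= in_itv/= andbT => t0; rewrite dE// normrM (ger0_norm (expR_ge0 _)).
  by rewrite ler_piMr ?cos_max ?expR_ge0.
have h s : is_derive s (1 : R) (fun s => \int[leb]_(t in D) f s t) (e / (e ^+ 2 + s ^+ 2)).
  have Is : `]s - 1, s + 1[%classic s by rewrite /= in_itv/=; apply/andP; split; lra.
  have ider (u t : R) : `]s - 1, s + 1[%classic u -> D t -> derivable (f ^~ t) u 1.
    move=> _; rewrite /= in_itv/= andbT => t0.
    exact: (@ex_derive _ _ _ _ _ _ _ (d1 u t t0)).
  apply: DeriveDef.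
    apply: (@derivable_under_integral R _ _ leb f D _ s (s - 1) (s + 1) Is _ ider
      (fun t => expR (- (e * t)))) => //.
    + by move=> u _; exact: int_sinc.
    + exact: integrable_expR_oy.
    + by move=> u t _; exact: bnd.
  rewrite -derive1E.
  rewrite (@differentiation_under_integral R _ _ leb f D _ s (s - 1) (s + 1) Is _ ider
      (fun t => expR (- (e * t)))) => //.
  - transitivity (\int[leb]_(t in D) (expR (- (e * t)) * cos (t * s))).
      by apply: eq_Rintegral => t; rewrite inE/= in_itv/= andbT => t0; rewrite dE.
    rewrite Rintegral_itv_obnd_cbnd ?Rintegral_expR_cos//.
    apply: le_integrable integrable_expR_oy => //.
      apply/measurable_EFinP; apply: measurable_funTS; apply: measurable_funM => //.
      by apply: measurable_cos; exact: measurable_funM.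
    by move=> t _; rewrite lee_fin normrM ler_piMr// cos_max.
  - by move=> u _; exact: int_sinc.
  - exact: integrable_expR_oy.
  - by move=> u t _; exact: bnd.
have da (s : R) : is_derive s (1 : R) (fun s => atan (s / e)) (e / (e ^+ 2 + s ^+ 2)).
  apply: is_derive_eq; rewrite /GRing.scale/=; field.
  rewrite !lt0r_neq0//= ltr_wpDr ?sqr_ge0// exprn_gt0//.
have d0 (s : R) : is_derive s (1 : R) (fun s => \int[leb]_(t in D) f s t - atan (s / e)) 0.
  have hs := h s; have das := da s.
  by apply: is_derive_eq; rewrite subrr.
have := is_derive_0_is_cst x 0 d0; rewrite /= mul0r atan0 subr0.
rewrite (_ : \int[leb]_(t in D) f 0 t = 0); first by move/eqP; rewrite subr_eq0 => /eqP.
transitivity (\int[leb]_(t in D) (0 : R)); last by rewrite Rintegral_cst ?mul0r.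
by apply: eq_Rintegral => t _; rewrite /f mulr0 sin0 mul0r !mulr0.
Qed.

Section smoothed_cdf.
Variables (mu : probability R R) (s : R).
Hypothesis imu : mu.-integrable setT (EFin \o (fun x : R => `|x|)).
Hypothesis odd_mu : forall t, \int[mu]_x sin (t * x) = 0.

Let g (z : R * R) := expR (- (e * z.2)) * (sin (z.2 * (s - z.1)) / z.2) * \1_D z.2.

Let mg : measurable_fun setT g.
Proof.
apply: measurable_funM; last first.
  by apply: measurableT_comp => //; exact: measurable_indic.
apply: measurable_funM; first exact: (measurableT_comp mexp).
apply: measurable_funM.
  by apply: measurable_sin; apply: measurable_funM => //; exact: measurable_funB.
by apply: (measurableT_comp (@measurable_invr R)).
Qed.

Let gE x t : g (x, t) = ((fun t => expR (- (e * t)) * (sin (t * (s - x)) / t)) \_ D) t.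
Proof. by rewrite /g patchE indicE /=; case: ifP => _; rewrite ?mulr1 ?mulr0. Qed.

Let ig : (mu \x leb)%E.-integrable setT (EFin \o g).
Proof.
apply/integrable12ltyP; first exact/measurable_EFinP.
apply: (@le_lt_trans _ _ (\int[mu]_x (`|(e^-1 * (`|s| + `|x|))%:E|))%E).
  apply: ge0_le_integral => //.
  - by move=> x _; exact: integral_ge0.
  - apply: (@measurable_fun_fubini_tonelli_F _ _ _ _ _ leb (fun z => `|(g z)%:E|%E)) => //.
    exact/measurableT_comp/measurable_EFinP.
  - apply: measurableT_comp => //; apply/measurable_EFinP.
    by apply: measurable_funM => //; exact: measurable_funD.
  move=> x _ /=.
  have -> : (\int[leb]_y `|g (x, y)|%:E =
      \int[leb]_(t in D) `|expR (- (e * t)) * (sin (t * (s - x)) / t)|%:E)%E.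
    rewrite [RHS]integral_mkcond; apply: eq_integral => t _.
    by rewrite gE !patchE; case: ifP => //; rewrite normr0.
  apply: (@le_trans _ _ (\int[leb]_(t in D) (`|s - x| * expR (- (e * t)))%:E)%E).
    apply: ge0_le_integral => //.
    - apply/measurable_EFinP; apply: measurable_funTS; apply: measurableT_comp => //.
      exact: (measurable_funM mexp (msinc (s - x))).
    - by apply/measurable_EFinP; apply: measurable_funTS; exact: (measurable_funM _ mexp).
    move=> t /=; rewrite in_itv/= andbT => t0.
    rewrite lee_fin normrM (ger0_norm (expR_ge0 _)) mulrC ler_wpM2r ?expR_ge0//.
    exact: normr_sinc_le.
  under eq_integral do rewrite EFinM.
  rewrite integralZl//; last exact: integrable_expR_oy.
  rewrite -(fineK (integrable_fin_num _ integrable_expR_oy))//.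
  rewrite -[fine _]/(Rintegral _ _ _) Rintegral_expR_oy lee_fin mulrC.
  rewrite [leRHS]ger0_norm; last by rewrite mulr_ge0 ?addr_ge0// invr_ge0 ltW.
  by rewrite ler_wpM2l ?ler_normB// invr_ge0 ltW.
have : mu.-integrable setT (fun x => (e^-1%:E * (`|s| + `|x|)%:E)%E).
  apply: integrableZl => //.
  rewrite (_ : (fun _ => _) = (EFin \o cst `|s|) \+ (EFin \o (fun x : R => `|x|))).
    apply: integrableD => //; apply: (integrable_of_bounded _ (M := `|s|)) => // x.
    by rewrite normr_id.
  by apply/funext => x.
by move=> /integrableP[].
Qed.

Let innerE t : (\int[mu]_x (g (x, t))%:E =
  (((fun t => expR (- (e * t)) * (sin (t * s) / t) * \int[mu]_x cos (t * x)) \_ D) t)%:E)%E.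
Proof.
have mcos : measurable_fun setT (fun x : R => cos (t * x)).
  by apply: measurable_cos; exact: measurable_funM.
have msin : measurable_fun setT (fun x : R => sin (t * x)).
  by apply: measurable_sin; exact: measurable_funM.
have icos (a : R) : mu.-integrable setT (EFin \o (fun x : R => a * cos (t * x))).
  apply: (integrable_of_bounded _ (M := `|a|)); first exact: measurable_funM.
  by move=> x; rewrite normrM ler_piMr ?cos_max.
have isin (a : R) : mu.-integrable setT (EFin \o (fun x : R => a * sin (t * x))).
  apply: (integrable_of_bounded _ (M := `|a|)); first exact: measurable_funM.
  by move=> x; rewrite normrM ler_piMr ?sin_max.
pose c := expR (- (e * t)) / t * \1_D t.
have gsplit x : g (x, t) = c * sin (t * s) * cos (t * x) - c * cos (t * s) * sin (t * x).
  by rewrite /g /= mulrBr sinB /c; ring.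
have icos1 : mu.-integrable setT (EFin \o (fun x : R => cos (t * x))).
  by have := icos 1; under eq_fun do rewrite mul1r.
have isin1 : mu.-integrable setT (EFin \o (fun x : R => sin (t * x))).
  by have := isin 1; under eq_fun do rewrite mul1r.
under eq_integral do rewrite gsplit.
rewrite -[LHS]fineK; last first.
  apply: integrable_fin_num => //.
  exact: (integrableB measurableT (icos _) (isin _)).
rewrite -[fine _]/(Rintegral _ _ _) RintegralB//.
rewrite !RintegralZl// odd_mu mulr0 subr0; congr EFin.
rewrite patchE /c indicE; case: ifP => _; last by rewrite !mulr0 !mul0r.
by rewrite mulr1; ring.
Qed.

Lemma integrable_smoothed_cdf :
  leb.-integrable D (EFin \o (fun t => expR (- (e * t)) * (sin (t * s) / t) * \int[mu]_x cos (t * x))).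
Proof.
apply/(integrable_mkcond _ _).2 => //.
have mG := measurable_fubini_G ig.
have mEg : measurable_fun setT (EFin \o g) by exact/measurable_EFinP.
have iG := (@integrable21ltyP _ _ _ _ _ mu leb (EFin \o g) mEg).1 ig.
apply/integrableP; split.
  apply: eq_measurable_fun mG => t _.
  by rewrite /fubini_G /= innerE restrict_EFin.
apply: le_lt_trans iG.
apply: ge0_le_integral => //.
- apply: measurableT_comp => //.
  apply: eq_measurable_fun mG => t _.
  by rewrite /fubini_G /= innerE restrict_EFin.
- apply: (@measurable_fun_fubini_tonelli_G _ _ _ _ _ mu (fun z => `|(g z)%:E|%E)) => //.
  exact/measurableT_comp/measurable_EFinP.
move=> t _; apply: (@le_trans _ _ `|\int[mu]_x (g (x, t))%:E|%E).
  by rewrite innerE restrict_EFin.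
apply: le_abse_integral => //; apply/measurable_EFinP.
exact: (measurableT_comp mg).
Qed.

(** Insert [Rintegral_expR_sinc] and exchange the integrals. In the expansion of
    sin(t (s - x)) the term with sin(t x) integrates to 0 under mu. Absolute
    integrability comes from |sin(t (s - x))/t| <= |s| + |x|. *)
Lemma smoothed_cdf_fourier : \int[mu]_x atan ((s - x) / e) =
  \int[leb]_(t in D) (expR (- (e * t)) * (sin (t * s) / t) * \int[mu]_x cos (t * x)).
Proof.
rewrite [RHS]Rintegral_mkcond; congr fine.
under [RHS]eq_integral do rewrite -innerE.
rewrite -(Fubini ig); apply: eq_integral => x _ /=.
rewrite -Rintegral_expR_sinc /Rintegral fineK; last first.
  by apply: integrable_fin_num => //; exact: int_sinc.
rewrite integral_mkcond; apply: eq_integral => t _.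
by rewrite gE restrict_EFin.
Qed.

End smoothed_cdf.

(** As |sin(t s)| <= 1, the kernel sin(t s)/t is at most 1/t uniformly in s; the
    factor t in front of B compensates for it. *)
Lemma smoothed_cdf_dist (mu nu : probability R R) (s : R) (B : R -> R) :
  mu.-integrable setT (EFin \o (fun x : R => `|x|)) ->
  nu.-integrable setT (EFin \o (fun x : R => `|x|)) ->
  (forall t, \int[mu]_x sin (t * x) = 0) -> (forall t, \int[nu]_x sin (t * x) = 0) ->
  leb.-integrable D (EFin \o (fun t => expR (- (e * t)) * B t)) ->
  (forall t, 0 < t -> `|\int[mu]_x cos (t * x) - \int[nu]_x cos (t * x)| <= t * B t) ->
  `|\int[mu]_x atan ((s - x) / e) - \int[nu]_x atan ((s - x) / e)| <=
     \int[leb]_(t in D) (expR (- (e * t)) * B t).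
Proof.
move=> imu inu omu onu iB munu.
have i1 := integrable_smoothed_cdf s imu omu.
have i2 := integrable_smoothed_cdf s inu onu.
rewrite !smoothed_cdf_fourier// -RintegralB//.
have mD : measurable (D : set (measurableTypeR R)) by exact: measurable_itv.
pose G t := expR (- (e * t)) * (sin (t * s) / t) * \int[mu]_x cos (t * x) -
  expR (- (e * t)) * (sin (t * s) / t) * \int[nu]_x cos (t * x).
have iG : leb.-integrable D (EFin \o G) by exact: (integrableB mD i1 i2).
apply: (le_trans (le_normr_Rintegral mD iG)).
apply: le_Rintegral => //; first exact: (integrable_norm iG).
move=> t /=; rewrite in_itv/= andbT => t0.
rewrite /G -mulrBr !normrM (ger0_norm (expR_ge0 _)) -mulrA ler_wpM2l ?expR_ge0//.
rewrite [X in _ * X * _]gtr0_norm ?invr_gt0// mulrAC ler_pdivrMr// (mulrC (B t)).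
by apply: le_trans (munu _ t0); rewrite ler_piMl// sin_max.
Qed.

End atan_fourier.

(** * Removing the smoothing *)

(** Use atan(1/x) = pi/2 - atan x and atan y <= y. *)
Lemma atan_ge_tail (R : realType) (x : R) : 0 < x -> pi / 2 - x^-1 <= atan x.
Proof.
move=> x0.
have ax0 : 0 < atan x by rewrite -(atan0 R) lt_atan.
have e : atan x^-1 = pi / 2 - atan x.
  have <- : tan (pi / 2 - atan x) = x^-1.
    rewrite -[in RHS](atanK x) /tan invf_div -opprB sinN cosN sinBpihalf cosBpihalf.
    by rewrite opprK.
  rewrite tanK// in_itv/=; have := atan_ltpi2 x; have := pi_gt0 R; lra.
have : atan x^-1 <= x^-1.
  have d (y : R) : is_derive y (1 : R) (fun y => y - atan y) (1 - (1 + y ^+ 2)^-1).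
    by apply: is_derive_eq.
  have x10 : 0 <= x^-1 by rewrite invr_ge0 ltW.
  have := ge0_derive_ge_at0 d _ x10; rewrite atan0 subr0 (subr_ge0 (atan _)); apply.
  by move=> y _; rewrite subr_ge0 invf_le1 ?lerDl ?sqr_ge0// ltr_pwDl// sqr_ge0.
by rewrite e; lra.
Qed.

(** The kernel 1/2 + atan((s - x)/e)/pi lies between 0 and 1, and it is within
    tau of the indicator of x <= s as soon as x is at distance at least eta
    from s. Hence the smoothed distribution functions at s - eta and s + eta
    frame the true one at s, up to tau. *)
Section smoothing.
Variables (R : realType) (e eta : R).
Hypotheses (e0 : 0 < e) (eta0 : 0 < eta).
Let tau := e / (eta * pi).
Let F (mu : probability R R) (s : R) := fine (mu `]-oo, s]%classic).
Let A (mu : probability R R) (s : R) := \int[mu]_x atan ((s - x) / e).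

Let pi0 : 0 < pi :> R. Proof. exact: pi_gt0. Qed.

Let tau_tail (y : R) : eta / e <= y -> 1 - tau <= 1 / 2 + atan y / pi.
Proof.
move=> /le_atan; have := @atan_ge_tail R (eta / e) (divr_gt0 eta0 e0).
rewrite invf_div => h1 h2; have h := le_trans h1 h2.
have : (pi / 2 - e / eta) / pi <= atan y / pi by rewrite ler_pM2r ?invr_gt0.
have -> : (pi / 2 - e / eta) / pi = 1 / 2 - tau.
  have pn : pi != 0 :> R by exact: lt0r_neq0.
  have en : eta != 0 by exact: lt0r_neq0.
  have aux (p : R) : p != 0 -> (p / 2 - e / eta) / p = 1 / 2 - e / (eta * p).
    by move=> p0; field; rewrite p0 en.
  exact: aux.
lra.
Qed.

Let smooth_bounds (y : R) : 0 <= 1 / 2 + atan y / pi <= 1.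
Proof.
have h1 : - (1 / 2) <= atan y / pi.
  by rewrite ler_pdivlMr//; have := atan_gtNpi2 y; lra.
have h2 : atan y / pi <= 1 / 2.
  by rewrite ler_pdivrMr//; have := atan_ltpi2 y; lra.
lra.
Qed.

Let tau0 : 0 <= tau.
Proof. by rewrite divr_ge0 ?ltW// mulr_gt0. Qed.

Let matan (s : R) : measurable_fun setT (fun x : R => atan ((s - x) / e)).
Proof.
apply: (measurableT_comp (f := @atan R)).
  by apply: continuous_measurable_fun => x; exact: continuous_atan.
by apply: measurable_funM => //; exact: measurable_funB.
Qed.

Let iatan (mu : probability R R) (s : R) :
  mu.-integrable setT (EFin \o (fun x : R => atan ((s - x) / e))).
Proof.
apply: (integrable_of_bounded _ (M := pi)) => // x; rewrite ler_norml.
by have := atan_gtNpi2 ((s - x) / e); have := atan_ltpi2 ((s - x) / e); lra.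
Qed.

Let iind (mu : probability R R) (s : R) :
  mu.-integrable setT (EFin \o (\1_(`]-oo, s]%classic) : R -> R)).
Proof.
apply: (integrable_of_bounded _ (M := 1)); last exact: normr_indic_le1.
by apply: measurable_indic; exact: measurable_itv.
Qed.

Let icst (mu : probability R R) (r : R) : mu.-integrable setT (EFin \o (fun=> r)).
Proof. exact: (integrable_of_bounded _ (M := `|r|)). Qed.

Let iatanpi (mu : probability R R) (s : R) :
  mu.-integrable setT (EFin \o (fun x : R => atan ((s - x) / e) / pi)).
Proof.
rewrite (_ : _ \o _ = fun x => ((pi^-1)%:E * (atan ((s - x) / e))%:E)%E).
  by apply: integrableZl => //; exact: iatan.
by apply/funext => x /=; rewrite mulrC EFinM.
Qed.

Let iA (mu : probability R R) (s c : R) :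
  mu.-integrable setT (EFin \o (fun x : R => c + atan ((s - x) / e) / pi)).
Proof. exact: (integrableD measurableT (icst _ _) (iatanpi _ _)). Qed.

Let FE (mu : probability R R) s : F mu s = \int[mu]_x \1_(`]-oo, s]%classic) x.
Proof. by rewrite Rintegral_indic_prob//; exact: measurable_itv. Qed.

Let AE (mu : probability R R) s c :
  \int[mu]_x (c + atan ((s - x) / e) / pi) = c + A mu s / pi.
Proof.
rewrite (RintegralD measurableT (icst _ _) (iatanpi _ _)) Rintegral_prob_cst.
by rewrite RintegralZr//; exact: iatan.
Qed.

Lemma cdf_le_smoothed (mu : probability R R) s :
  F mu s <= 1 / 2 + tau + A mu (s + eta) / pi.
Proof.
rewrite FE -AE; apply: (le_Rintegral measurableT (iind _ _) (iA _ _ _)).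
move=> x _; rewrite indicE; case: (boolP (x \in _)) => [|_].
  rewrite inE/= in_itv/= => xs.
  have : 1 - tau <= 1 / 2 + atan ((s + eta - x) / e) / pi.
    by apply: tau_tail; rewrite ler_pM2r ?invr_gt0//; lra.
  lra.
by have := tau0; have := smooth_bounds ((s + eta - x) / e); rewrite /=; lra.
Qed.

Lemma smoothed_le_cdf (mu : probability R R) s :
  1 / 2 - tau + A mu (s - eta) / pi <= F mu s.
Proof.
rewrite FE -AE; apply: (le_Rintegral measurableT (iA _ _ _) (iind _ _)).
move=> x _; rewrite indicE; case: (boolP (x \in _)) => [_|].
  by have := tau0; have := smooth_bounds ((s - eta - x) / e); rewrite /=; lra.
rewrite notin_setE/= in_itv/= => /negP; rewrite -ltNge => xs.
have : 1 - tau <= 1 / 2 + atan ((x + eta - s) / e) / pi.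
  by apply: tau_tail; rewrite ler_pM2r ?invr_gt0//; lra.
have -> : (s - eta - x) / e = - ((x + eta - s) / e) by ring.
by rewrite atanN mulNr; lra.
Qed.

(** Go from F mu s to a smoothed value at s +- eta, cross over to nu, and come
    back at s +- 2 eta, where the Lipschitz bound for nu applies. *)
Lemma cdf_dist_le_smoothed (mu nu : probability R R) (L Delta : R) :
  (forall s, `|A mu s - A nu s| <= Delta) ->
  (forall s t, s <= t -> F nu t - F nu s <= L * (t - s)) ->
  forall s, `|F mu s - F nu s| <= Delta / pi + 2 * tau + 2 * eta * L.
Proof.
move=> munu lip s.
have D1 : `|A mu (s + eta) / pi - A nu (s + eta) / pi| <= Delta / pi.
  by rewrite -mulrBl normrM [X in _ * X]gtr0_norm ?invr_gt0// ler_pM2r ?invr_gt0.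
have D2 : `|A mu (s - eta) / pi - A nu (s - eta) / pi| <= Delta / pi.
  by rewrite -mulrBl normrM [X in _ * X]gtr0_norm ?invr_gt0// ler_pM2r ?invr_gt0.
have u1 := cdf_le_smoothed mu s.
have u2 := smoothed_le_cdf nu (s + eta + eta).
have l1 := smoothed_le_cdf mu s.
have l2 := cdf_le_smoothed nu (s - eta - eta).
rewrite addrK in u2; rewrite subrK in l2.
have L1 : F nu (s + eta + eta) - F nu s <= L * (s + eta + eta - s).
  by apply: lip; rewrite -addrA lerDl addr_ge0 ?ltW.
have L2 : F nu s - F nu (s - eta - eta) <= L * (s - (s - eta - eta)).
  by apply: lip; rewrite -addrA gerDl -opprD oppr_le0 addr_ge0 ?ltW.
have e1 : L * (s + eta + eta - s) = 2 * eta * L by ring.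
have e2 : L * (s - (s - eta - eta)) = 2 * eta * L by ring.
rewrite e1 in L1; rewrite e2 in L2.
move: D1 D2; rewrite !ler_norml => /andP[? ?] /andP[? ?].
by apply/andP; split; lra.
Qed.

End smoothing.

Lemma normal_prob01_itv_le (R : realType) (s t : R) : s <= t ->
  fine (normal_prob 0 1 `]-oo, t]) - fine (normal_prob 0 1 `]-oo, s]) <= 1 / 2 * (t - s).
Proof.
move=> st.
have st_itv : `]-oo, t]%classic = `]-oo, s] `|` `]s, t] :> set R.
  by rewrite -itv_bndbnd_setU// ?bnd_simp.
have disj : (`]-oo, s] `&` `]s, t] = set0 :> set R).
  rewrite -subset0 => x [] /=; rewrite !in_itv/= => xs /andP[sx _].
  by move: (lt_le_trans sx xs); rewrite ltxx.
have -> : normal_prob 0 1 `]-oo, t] = (normal_prob 0 1 `]-oo, s] + normal_prob 0 1 `]s, t])%E.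
  by rewrite st_itv measureU//; exact: measurable_itv.
rewrite fineD ?fin_num_measure//; try exact: measurable_itv.
rewrite addrAC subrr add0r.
rewrite -lee_fin fineK ?fin_num_measure//.
apply: (@le_trans _ _ (\int[lebesgue_measure]_(x in `]s, t]) (cst (1 / 2)%:E) x)%E).
  rewrite /normal_prob; apply: ge0_le_integral => //.
  - by move=> x _; rewrite lee_fin normal_pdf_ge0.
  - by apply/measurable_EFinP; apply: measurable_funTS; exact: measurable_normal_pdf.
  move=> x _; rewrite lee_fin (le_trans (normal_pdf_ub _ _ _))//; exact: normal_peak1_le_half.
rewrite integral_cst//.
rewrite /= lebesgue_measure_itv/= lte_fin; case: ifP => [_|/negbT]; first by rewrite -EFinM.
by rewrite -leNgt => ts; rewrite mule0 lee_fin mulr_ge0// subr_ge0.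
Qed.

(** * Characteristic function away from the origin *)

Lemma Rintegral_cos_itv (R : realType) (u a w : R) : u != 0 -> 0 < w ->
  \int[lebesgue_measure]_(x in `[a, a + w[) cos (u * x) =
    (sin (u * (a + w)) - sin (u * a)) / u.
Proof.
move=> u0 w0.
have d (x : R) : is_derive x (1 : R) (fun x => sin (u * x) / u) (cos (u * x)).
  by apply: is_derive_eq; rewrite /GRing.scale/=; field.
have cd := is_derive_continuous d.
have cc : continuous (fun x => cos (u * x)).
  apply: (is_derive_continuous (f' := fun x => - sin (u * x) * u)) => x.
  by apply: is_derive_eq; rewrite /GRing.scale/=; ring.
have mc : measurable_fun setT (fun x : R => cos (u * x)) by exact: continuous_measurable_fun.
rewrite /Rintegral integral_itv_bndo_bndc; last first.
  by apply/measurable_EFinP; exact: measurable_funTS.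
rewrite (@continuous_FTC2 _ _ (fun x => sin (u * x) / u)).
- by rewrite -EFinB /= mulrBl.
- by rewrite ltrDl.
- exact: continuous_subspaceT.
- split => [x _||]; first exact: (@ex_derive _ _ _ _ _ _ _ (d x)).
  + by apply: cvg_at_right_filter; exact: cd.
  + by apply: cvg_at_left_filter; exact: cd.
- by move=> x _; rewrite derive1E (@derive_val _ _ _ _ _ _ _ (d x)).
Qed.

(** The difference of sines is a product of a sine and a cosine centred at the
    midpoint of the interval; only the length of the interval matters. *)
Lemma normr_Rintegral_cos_itv (R : realType) (u a w : R) : u != 0 -> 0 < w ->
  `|\int[lebesgue_measure]_(x in `[a, a + w[) cos (u * x)| <=
    2 * `|sin (u * w / 2)| / `|u|.
Proof.
move=> u0 w0; rewrite Rintegral_cos_itv//.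
have -> : sin (u * (a + w)) - sin (u * a) =
    2 * sin (u * w / 2) * cos (u * a + u * w / 2).
  have -> : u * (a + w) = (u * a + u * w / 2) + u * w / 2 by field.
  have -> : sin (u * a) = sin ((u * a + u * w / 2) - u * w / 2) by congr sin; ring.
  by rewrite sinD sinB; ring.
rewrite !normrM normfV ler_wpM2r ?invr_ge0// ger0_norm// ler_piMr ?cos_max//.
Qed.

Section law_with_density.
Variables (R : realType) (mu : probability R R) (h w : R).
Hypotheses (h01 : 0 < h <= 1) (w01 : 0 < w <= 1).
Notation leb := (@lebesgue_measure R).

Let h0 : 0 < h. Proof. by case/andP: h01. Qed.
Let w0 : 0 < w. Proof. by case/andP: w01. Qed.

(** The absolutely continuous part has density at least h on the interval and the
    singular part is nonnegative, so the law dominates h times Lebesgue measure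
    there; [le_integral_weighted] passes from sets to functions. *)
Lemma assumption1_minorization : assumption1 h w mu ->
  exists a : R, forall f : R -> R, measurable_fun setT f -> (forall x, 0 <= f x) ->
    (\int[leb]_(x in `[a, (a + w)%R[) (h * f x)%:E <= \int[mu]_x (f x)%:E)%E.
Proof.
move=> [mud [mus [p [[_ _ muE] [mp p0 mudE] [a pa]]]]]; exists a => f mf f0.
have mI : measurable (`[a, (a + w)%R[ : set R) by exact: measurable_itv.
have := @le_integral_weighted _ _ _ _ _ _ R leb (fun x => h * \1_(`[a, (a + w)%R[) x) id mu (cst 1) id.
move=> /(_ _ _ _ _ _ _ _ f mf f0) key.
have -> : (\int[leb]_(x in `[a, (a + w)%R[) (h * f x)%:E =
    \int[leb]_x (h * \1_(`[a, (a + w)%R[) x * f x)%:E)%E.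
  rewrite integral_mkcond; apply: eq_integral => x _.
  by rewrite patchE indicE; case: ifP => _; rewrite ?mulr1 ?mulr0 ?mul0r.
have -> : (\int[mu]_x (f x)%:E = \int[mu]_x (cst 1 x * f x)%:E)%E.
  by apply: eq_integral => x _; rewrite mul1r.
apply: key => //.
- by apply: measurable_funM => //; exact: measurable_indic.
- by move=> x; rewrite mulr_ge0// ltW.
move=> B mB; under [leRHS]eq_integral do rewrite mul1r.
rewrite integral_indic// setIT.
have -> : (\int[leb]_x (h * \1_(`[a, (a + w)%R[) x * \1_B (id x))%:E =
    \int[leb]_(x in B `&` `[a, (a + w)%R[) h%:E)%E.
  rewrite [RHS]integral_mkcond; apply: eq_integral => x _.
  rewrite patchE !indicE in_setI.
  by case: (x \in B); case: (x \in `[a, (a + w)%R[%classic); rewrite /= ?mulr1 ?mulr0 ?mul1r ?mul0r.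
have mBI : measurable (B `&` `[a, (a + w)%R[) by exact: measurableI.
apply: (@le_trans _ _ (mud (B `&` `[a, (a + w)%R[))).
  rewrite mudE//; apply: ge0_le_integral => //.
  - by move=> x _; rewrite lee_fin ltW.
  - by apply/measurable_EFinP; exact: measurable_funTS.
  - by move=> x [_ xI]; rewrite lee_fin; apply: pa.
apply: (@le_trans _ _ (mud B)); first by rewrite le_measure ?inE//; exact: subIsetl.
by rewrite muE// leeDl.
Qed.

(** Applying the minorization to 1 + cos(u x) and to 1 - cos(u x), which are
    nonnegative, bounds the integral of the cosine on both sides by what the
    interval contributes. *)
Lemma normr_chf_density_le : assumption1 h w mu -> forall u : R, u != 0 ->
  `|\int[mu]_x cos (u * x)| <= 1 - h * w + h * (2 * `|sin (u * w / 2)| / `|u|).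
Proof.
move=> /assumption1_minorization[a key] u u0.
have mcos : measurable_fun setT (fun x : R => cos (u * x)).
  by apply: measurable_cos; exact: measurable_funM.
have lebI : leb `[a, a + w[%classic = w%:E.
  rewrite lebesgue_measure_itv/= lte_fin ltrDl w0.
  by rewrite -EFinB addrC addKr.
have Icos : leb.-integrable `[a, a + w[ (EFin \o (fun x => cos (u * x))).
  apply: measurable_bounded_integrable => //.
  - by rewrite [ltLHS]lebI ltry.
  - exact: measurable_funTS.
  - exists 1; split; first exact: num_real.
    by move=> y y1 x _ /=; rewrite (le_trans (cos_max _))// ltW.
have Icst (r : R) : leb.-integrable `[a, a + w[ (EFin \o cst r).
  apply: measurable_bounded_integrable => //.
  - by rewrite [ltLHS]lebI ltry.
  - exists `|r|; split; first exact: num_real.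
    by move=> y y1 x _ /=; exact: ltW.
have mucos : mu.-integrable setT (EFin \o (fun x => cos (u * x))).
  by apply: (integrable_of_bounded _ (M := 1)) => // x; exact: cos_max.
have mucst (r : R) : mu.-integrable setT (EFin \o cst r).
  by apply: (integrable_of_bounded _ (M := `|r|)).
(* s is a sign, so that 1 + s * cos (u * x) is nonnegative *)
have bound (s : R) : `|s| = 1 ->
    h * (w + s * \int[leb]_(x in `[a, a + w[) cos (u * x)) <= 1 + s * \int[mu]_x cos (u * x).
  move=> s1.
  have f0 x : 0 <= 1 + s * cos (u * x).
    have : `|s * cos (u * x)| <= 1 by rewrite normrM s1 mul1r cos_max.
    by rewrite ler_norml => /andP[]; lra.
  have mf : measurable_fun setT (fun x => 1 + s * cos (u * x)).
    by apply: measurable_funD => //; exact: measurable_funM.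
  have := key _ mf f0.
  have IZ : leb.-integrable `[a, a + w[ (EFin \o (fun x => s * cos (u * x))).
    exact: (integrableZl _ s Icos).
  have ID : leb.-integrable `[a, a + w[ (EFin \o (fun x => 1 + s * cos (u * x))).
    exact: (integrableD _ (Icst 1) IZ).
  have muZ : mu.-integrable setT (EFin \o (fun x => s * cos (u * x))).
    exact: (integrableZl _ s mucos).
  have muD : mu.-integrable setT (EFin \o (fun x => 1 + s * cos (u * x))).
    exact: (integrableD _ (mucst 1) muZ).
  have hID : leb.-integrable `[a, a + w[ (EFin \o (fun x => h * (1 + s * cos (u * x)))).
    exact: (integrableZl _ h ID).
  rewrite -(fineK (integrable_fin_num _ hID))// -(fineK (integrable_fin_num _ muD))//.
  rewrite lee_fin -[X in X <= _]/(Rintegral _ _ _) -[X in _ <= X]/(Rintegral _ _ _).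
  rewrite (RintegralZl _ _ ID)// (RintegralD _ (Icst 1) IZ)// (RintegralD _ (mucst 1) muZ)//.
  rewrite (RintegralZl _ _ Icos)// (RintegralZl _ _ mucos)// Rintegral_prob_cst.
  by rewrite Rintegral_cst// [X in fine X]lebI mul1r.
have J := normr_Rintegral_cos_itv a u0 w0.
have b1 := bound 1 (normr1 _); have bm := bound (-1) (etrans (normrN _) (normr1 _)).
move: J; set I := \int[leb]_(x in _) _ in b1 bm *; set K := _ / `|u|.
rewrite ler_norml => /andP[J1 J2]; rewrite ler_norml; apply/andP; split.
  by have := h0; nra.
by have := h0; nra.
Qed.

(** With v = u w/2 the previous bound is 1 - h w (1 - |sin v|/v), and v^2 is at
    least w^2/(2 m) when u^2 >= 2/m, so [sinc_le] applies. *)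
Lemma normr_chf_away0 (m u : R) : assumption1 h w mu -> 1 <= m -> 2 / m <= u ^+ 2 ->
  `|\int[mu]_x cos (u * x)| <= expR (- (3 * h * w ^+ 3 / (160 * m))).
Proof.
move=> A1 m1 um.
have m0 : 0 < m by exact: lt_le_trans m1.
have u2 : 0 < u ^+ 2 by apply: lt_le_trans um; rewrite divr_gt0.
wlog u0 : u um u2 / 0 < u.
  move=> H; have [u0|u0|u0] := ltgtP u 0.
  - have := H (- u); rewrite sqrrN oppr_gt0 => /(_ um u2 u0); congr (`|_| <= _).
    by apply: eq_Rintegral => x _; rewrite mulNr cosN.
  - exact: H.
  - by move: u2; rewrite u0 expr0n/= ltxx.
apply: le_trans (normr_chf_density_le A1 (lt0r_neq0 u0)) _.
pose c := w ^+ 2 / (2 * m); pose v := u * w / 2.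
have v0 : 0 < v by rewrite divr_gt0// mulr_gt0.
have c0 : 0 <= c by rewrite divr_ge0 ?sqr_ge0// mulr_ge0// ltW.
have w1 : w <= 1 by case/andP: w01.
have c12 : c <= 1 / 2.
  rewrite /c ler_pdivrMr ?mulr_gt0//; have : w ^+ 2 <= 1 by rewrite expr_le1// ltW.
  lra.
have cv : c <= v ^+ 2.
  have -> : v ^+ 2 = u ^+ 2 * (w ^+ 2 / 4) by rewrite /v; field.
  have -> : c = 2 / m * (w ^+ 2 / 4) by rewrite /c; field; rewrite lt0r_neq0.
  by rewrite ler_wpM2r// divr_ge0// sqr_ge0.
have := sinc_le c0 c12 cv v0 => hs.
have e1 : 2 * `|sin v| / `|u| <= w * (1 - 3 * c / 80).
  rewrite (gtr0_norm u0) ler_pdivrMr//.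
  have -> : w * (1 - 3 * c / 80) * u = 2 * (v * (1 - 3 * c / 80)) by rewrite /v; field.
  by rewrite ler_pM2l.
have e2 : h * (2 * `|sin v| / `|u|) <= h * (w * (1 - 3 * c / 80)) by rewrite ler_pM2l.
apply: le_trans (expR_ge1Dx _).
have e3 : 3 * h * w ^+ 3 / (160 * m) = h * (w * (3 * c / 80)).
  by rewrite /c; field; rewrite lt0r_neq0.
rewrite e3 -/v; lra.
Qed.

End law_with_density.

(** * Characteristic function near the origin, and its powers *)

Section chf_moments.
Variables (R : realType) (mu : probability R R).
Hypothesis i4 : mu.-integrable setT (EFin \o (fun x : R => x ^+ 4)).
Hypothesis var1 : \int[mu]_x (x ^+ 2) = 1.
Let m := \int[mu]_x (x ^+ 4).

Let icst (r : R) : mu.-integrable setT (EFin \o (fun=> r)).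
Proof. exact: (integrable_of_bounded _ (M := `|r|)). Qed.

Let i2 : mu.-integrable setT (EFin \o (fun x : R => x ^+ 2)).
Proof.
have h : mu.-integrable setT (EFin \o (fun x : R => 1 + x ^+ 4)).
  exact: (integrableD measurableT (icst 1) i4).
apply: le_integrable h => //.
  by apply/measurable_EFinP; exact: measurable_funX.
move=> x _; rewrite /= lee_fin !ger0_norm ?sqr_ge0 ?addr_ge0//.
  have -> : x ^+ 4 = x ^+ 2 * x ^+ 2 by ring.
  by have := sqr_ge0 (x ^+ 2 - 1); nra.
all: by rewrite exprn_even_ge0.
Qed.

Let iZ (c : R) (f : R -> R) : mu.-integrable setT (EFin \o f) ->
  mu.-integrable setT (EFin \o (fun x => c * f x)).
Proof. by move=> h; exact: (integrableZl measurableT c h). Qed.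

(** Integrate (x^2 - 1)^2 >= 0. *)
Lemma fourth_moment_ge1 : 1 <= m.
Proof.
have h : 0 <= \int[mu]_x ((x ^+ 4 + (-2) * x ^+ 2) + 1).
  apply: Rintegral_ge0 => x _.
  have -> : x ^+ 4 + (-2) * x ^+ 2 + 1 = (x ^+ 2 - 1) ^+ 2 by ring.
  exact: sqr_ge0.
have i42 := integrableD measurableT i4 (iZ (-2) i2).
rewrite (RintegralD measurableT i42 (icst 1)) (RintegralD measurableT i4 (iZ (-2) i2)) in h.
rewrite RintegralZl// var1 Rintegral_prob_cst -/m in h.
lra.
Qed.

Lemma chf_taylor (u : R) :
  1 - u ^+ 2 / 2 <= \int[mu]_x cos (u * x) <= 1 - u ^+ 2 / 2 + m * u ^+ 4 / 24.
Proof.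
have mcos : measurable_fun setT (fun x : R => cos (u * x)).
  by apply: measurable_cos; exact: measurable_funM.
have icos : mu.-integrable setT (EFin \o (fun x : R => cos (u * x))).
  by apply: (integrable_of_bounded _ (M := 1)) => // x; exact: cos_max.
have ilow := integrableD measurableT (icst 1) (iZ (- (u ^+ 2 / 2)) i2).
have iupp := integrableD measurableT ilow (iZ (u ^+ 4 / 24) i4).
have elow : \int[mu]_x (1 + - (u ^+ 2 / 2) * x ^+ 2) = 1 - u ^+ 2 / 2.
  rewrite (RintegralD measurableT (icst 1) (iZ _ i2)) Rintegral_prob_cst.
  by rewrite RintegralZl// var1 mulr1.
apply/andP; split.
  rewrite -elow; apply: (le_Rintegral measurableT ilow icos) => x _.
  apply: le_trans (cos_ge_1Bsqr _); rewrite exprMn; lra.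
have -> : 1 - u ^+ 2 / 2 + m * u ^+ 4 / 24 =
    \int[mu]_x (1 + - (u ^+ 2 / 2) * x ^+ 2 + u ^+ 4 / 24 * x ^+ 4).
  rewrite (RintegralD measurableT ilow (iZ _ i4)) elow RintegralZl// -/m.
  by congr (_ + _); ring.
apply: (le_Rintegral measurableT icos iupp) => x _.
by apply: le_trans (cos_le_taylor4 _) _; rewrite !exprMn; lra.
Qed.

End chf_moments.

(** With u = t / sqrt N, the threshold m u^2 = 2 separates two regimes. Above it,
    each term is small by itself: t >= 1 because t^2 = N u^2 > 6, and
    exp(- t^2/2) is absorbed by the first summand as (m/N) t^2 = m u^2 >= 2.
    Below it, the bases differ by at most m u^4/8 and [normr_subX_le] applies
    with c = exp(- 5 u^2/12). *)
Lemma chf_power_close (R : realType) (N : nat) (m kappa : R) (phi : R -> R) :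
  1 <= m -> 3 * m < N%:R ->
  (forall u, 1 - u ^+ 2 / 2 <= phi u <= 1 - u ^+ 2 / 2 + m * u ^+ 4 / 24) ->
  (forall u, 2 / m <= u ^+ 2 -> `|phi u| <= expR (- kappa)) ->
  forall t, 0 < t ->
    `|phi (t / Num.sqrt N%:R) ^+ N - expR (- (t ^+ 2 / 2))| <=
    t * (m / N%:R * (t * expR (- (t ^+ 2 / 8))) + expR (- (N%:R * kappa))).
Proof.
move=> m1 Nm phi_taylor phi_away t t0.
have m0 : 0 < m by exact: lt_le_trans m1.
have N0 : 0 < N%:R :> R by apply: le_lt_trans Nm; rewrite mulr_ge0// ltW.
have N3 : 3 < N%:R :> R by apply: le_lt_trans Nm; lra.
set u := t / _.
have uE : u ^+ 2 = t ^+ 2 / N%:R by rewrite expr_div_n sqr_sqrtr// ltW.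
have tE : t ^+ 2 = N%:R * u ^+ 2 by rewrite uE mulrC divfK// lt0r_neq0.
have u0 : 0 <= u ^+ 2 by exact: sqr_ge0.
have [um|um] := leP (2 / m) (u ^+ 2).
  have mu2 : 2 <= m * u ^+ 2 by rewrite mulrC -ler_pdivrMr.
  have t2 : 1 <= t by nra.
  apply: le_trans (ler_normB _ _) _.
  have h1 : `|phi u ^+ N| <= t * expR (- (N%:R * kappa)).
    rewrite normrX -mulrN expRM_natl; apply: (@le_trans _ _ (expR (- kappa) ^+ N)).
      by rewrite lerXn2r// ?nnegrE ?expR_ge0// phi_away.
    by rewrite ler_peMl// exprn_ge0// expR_ge0.
  have h2 : `|expR (- (t ^+ 2 / 2))| <= t * (m / N%:R * (t * expR (- (t ^+ 2 / 8)))).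
    rewrite ger0_norm ?expR_ge0//.
    have -> : t * (m / N%:R * (t * expR (- (t ^+ 2 / 8)))) =
        (m * u ^+ 2) * expR (- (t ^+ 2 / 8)) by rewrite uE; field; rewrite lt0r_neq0.
    apply: (@le_trans _ _ (expR (- (t ^+ 2 / 8)))).
      by rewrite ler_expR; have := sqr_ge0 t; lra.
    by rewrite ler_peMl ?expR_ge0//; lra.
  by rewrite mulrDr; lra.
have mu2 : m * u ^+ 2 < 2 by rewrite mulrC -ltr_pdivlMr.
have u2 : u ^+ 2 <= 2 by nra.
have /andP[lo up] := phi_taylor u.
have u4E : u ^+ 4 = u ^+ 2 * u ^+ 2 by ring.
set c := expR (- (5 / 12 * u ^+ 2)).
set b := expR (- (u ^+ 2 / 2)).
have a0 : 0 <= phi u by lra.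
(* m u^4 / 24 <= u^2 / 12 in this regime, whence the exponent 5/12 *)
have ac : phi u <= c.
  apply: le_trans up _; apply: le_trans (expR_ge1Dx _).
  rewrite u4E; nra.
have bc : b <= c by rewrite ler_expR; lra.
have b0 : 0 <= b by exact: expR_ge0.
have b1 : 1 - u ^+ 2 / 2 <= b by exact: expR_ge1Dx.
have u20 : 0 <= u ^+ 2 / 2 by lra.
have b2 : b <= 1 - u ^+ 2 / 2 + u ^+ 4 / 8.
  have := expRN_le_taylor2 u20; rewrite -/b u4E; lra.
have ab : `|phi u - b| <= m * u ^+ 4 / 8.
  have u40 : 0 <= u ^+ 4 by rewrite u4E; nra.
  have : u ^+ 4 <= m * u ^+ 4 by nra.
  rewrite ler_norml => ?; apply/andP; split; lra.
have bN : b ^+ N = expR (- (t ^+ 2 / 2)).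
  by rewrite /b -expRM_natl tE; congr expR; ring.
rewrite -bN; apply: le_trans (normr_subX_le _ (_ : _ <= c) (_ : _ <= c)) _.
- by rewrite ger0_norm.
- by rewrite ger0_norm.
apply: (@le_trans _ _ (N%:R * c ^+ N.-1 * (m * u ^+ 4 / 8))).
  by rewrite ler_wpM2l// mulr_ge0// exprn_ge0// expR_ge0.
rewrite mulrDr -[leLHS]addr0 lerD//; last by rewrite mulr_ge0 ?expR_ge0// ltW.
(* 5 (N - 1) / 12 >= N / 4, which holds as N >= 3 *)
have cN : c ^+ N.-1 <= expR (- (t ^+ 2 / 4)).
  rewrite /c -expRM_natl ler_expR.
  have -> : N.-1%:R = N%:R - 1 :> R by rewrite -subn1 natrB// -(ltr_nat R) (lt_trans _ N3)// ltr_nat.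
  rewrite tE; nra.
(* half of the exponential absorbs a factor t^2 / 8, by expR_ge1Dx *)
have e8 : t ^+ 2 / 8 * expR (- (t ^+ 2 / 4)) <= expR (- (t ^+ 2 / 8)).
  have -> : - (t ^+ 2 / 8) = t ^+ 2 / 8 + - (t ^+ 2 / 4) by lra.
  rewrite expRD ler_wpM2r ?expR_ge0//.
  by apply: le_trans (expR_ge1Dx _); lra.
have -> : N%:R * c ^+ N.-1 * (m * u ^+ 4 / 8) = (m / N%:R * t ^+ 2) * (t ^+ 2 / 8 * c ^+ N.-1).
  by rewrite u4E uE; field; rewrite lt0r_neq0.
have -> : t * (m / N%:R * (t * expR (- (t ^+ 2 / 8)))) = (m / N%:R * t ^+ 2) * expR (- (t ^+ 2 / 8)).
  by ring.
rewrite ler_wpM2l//; first by rewrite mulr_ge0 ?sqr_ge0// divr_ge0// ltW.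
by apply: le_trans e8; rewrite ler_wpM2l// divr_ge0// sqr_ge0.
Qed.

(** * Distance to the standard normal law *)

(** Here nu is any law agreeing with the standard normal one on Borel sets. The
    scales e and eta balance the three errors: exp(- 3 K)/e, e/eta and eta are
    all equal to exp(- K). *)
Section ks_standard_normal.
Variables (R : realType) (mu : probability R R) (b K : R).
Hypotheses (b0 : 0 <= b).
Hypothesis imu : mu.-integrable setT (EFin \o (fun x : R => `|x|)).
Hypothesis odd_mu : forall t, \int[mu]_x sin (t * x) = 0.
Hypothesis chf_close : forall t, 0 < t ->
  `|\int[mu]_x cos (t * x) - expR (- (t ^+ 2 / 2))| <=
    t * (b * (t * expR (- (t ^+ 2 / 8))) + expR (- (3 * K))).
Notation leb := (@lebesgue_measure R).
Notation D := (`]0, +oo[%classic : set R).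

Variable nu : probability R R.
Hypothesis nuE : forall A : set R, measurable A -> nu A = normal_prob 0 1 A.

(** The sigma-algebras of R and of measurableTypeR have the same sets but carry
    different displays, so integrals are transported along the identity. *)
Let phi (x : R) : measurableTypeR R := x.

Let mphi : measurable_fun setT phi.
Proof. by move=> _ A mA; rewrite setTI. Qed.

Let int_phi (f : R -> \bar R) :
  (\int[pushforward nu phi]_x f x = \int[normal_prob 0 1]_x f x)%E.
Proof. by apply: eq_measure_integral => A mA _; exact: nuE. Qed.

Let ge0_int_nu (f : R -> R) : measurable_fun setT f -> (forall x, 0 <= f x) ->
  (\int[nu]_x (f x)%:E = \int[normal_prob 0 1]_x (f x)%:E)%E.
Proof.
move=> mf f0; rewrite -int_phi ge0_integral_pushforward//.
- exact/measurable_EFinP.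
- by move=> x _; rewrite lee_fin.
Qed.

Let inu : nu.-integrable setT (EFin \o (fun x : R => `|x|)).
Proof.
apply/integrableP; split; first by apply/measurable_EFinP.
rewrite (_ : \int[nu]_x _ = \int[nu]_x (`|x|)%:E)%E.
  by rewrite ge0_int_nu//; exact: integral_normal_prob01_normr_lty.
by apply: eq_integral => x _ /=; rewrite normr_id.
Qed.

Let cos_nu t a : \int[nu]_x cos (t * x + a) = expR (- (t ^+ 2 / 2)) * cos a.
Proof.
have mc : measurable_fun setT (fun x : R => cos (t * x + a)).
  by apply: measurable_cos; apply: measurable_funD => //; exact: measurable_funM.
rewrite -Rintegral_normal_prob01_cos /Rintegral -int_phi; congr fine.
rewrite (integral_pushforward mphi)//.
  exact/measurable_EFinP.
by apply: (integrable_of_bounded _ (M := 1)) => [|x]; [exact: mc|exact: cos_max].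
Qed.

Let odd_nu t : \int[nu]_x sin (t * x) = 0.
Proof.
under eq_Rintegral do rewrite -cosBpihalf.
by rewrite cos_nu cosN cos_pihalf mulr0.
Qed.

Let cos_nu0 t : \int[nu]_x cos (t * x) = expR (- (t ^+ 2 / 2)).
Proof.
have := cos_nu t 0; rewrite cos0 mulr1 => <-.
by apply: eq_Rintegral => x _; rewrite addr0.
Qed.

Let e := expR (- (2 * K)).
Let eta := expR (- K).
Let B t := b * (t * expR (- (t ^+ 2 / 8))) + expR (- (3 * K)).

Let e0 : 0 < e. Proof. exact: expR_gt0. Qed.

Let i1 : leb.-integrable D (EFin \o (fun t => b * (t * expR (- (t ^+ 2 / 8))))).
Proof. exact: (integrableZl _ b (integral_xexpR_sqr R).1). Qed.

Let i2 : leb.-integrable D (EFin \o (fun t => expR (- (3 * K)) * expR (- (e * t)))).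
Proof. exact: (integrableZl _ _ (integrable_expR_oy e0)). Qed.

Let i12 := integrableD (measurable_itv _ : measurable (D : set (measurableTypeR R))) i1 i2.

Let Ble t : D t -> 0 <= expR (- (e * t)) * B t <=
  b * (t * expR (- (t ^+ 2 / 8))) + expR (- (3 * K)) * expR (- (e * t)).
Proof.
rewrite /= in_itv/= andbT => t0.
have x0 := expR_ge0 (- (e * t)).
have x1 : expR (- (e * t)) <= 1 by rewrite expR_le1 oppr_le0 mulr_ge0// ltW.
have y0 : 0 <= b * (t * expR (- (t ^+ 2 / 8))) by rewrite !mulr_ge0 ?expR_ge0// ltW.
have z0 := expR_ge0 (- (3 * K)).
rewrite /B mulrDr; apply/andP; split; first by rewrite addr_ge0// mulr_ge0.
by rewrite lerD ?ler_piMl// mulrC.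
Qed.

Let iB : leb.-integrable D (EFin \o (fun t => expR (- (e * t)) * B t)).
Proof.
apply: le_integrable i12 => //.
  apply/measurable_EFinP; apply: measurable_funTS; apply: measurable_funM.
    by apply: measurableT_comp => //; apply: measurableT_comp => //; exact: measurable_funM.
  apply: measurable_funD => //; apply: measurable_funM => //; apply: measurable_funM => //.
  apply: measurableT_comp => //; apply: measurableT_comp => //; apply: measurable_funM => //.
move=> t Dt; have /andP[h0 h1] := Ble Dt.
by rewrite lee_fin ger0_norm// (le_trans h1)// ler_norm.
Qed.

Let intB : \int[leb]_(t in D) (expR (- (e * t)) * B t) <= 4 * b + eta.
Proof.
apply: le_trans (_ : _ <= \int[leb]_(t in D)
  (b * (t * expR (- (t ^+ 2 / 8))) + expR (- (3 * K)) * expR (- (e * t)))) _.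
  apply: (le_Rintegral _ iB i12) => // t Dt.
  by have /andP[] := Ble Dt.
rewrite (RintegralD _ i1 i2)// (RintegralZl _ _ (integral_xexpR_sqr R).1)//.
rewrite (RintegralZl _ _ (integrable_expR_oy e0))// Rintegral_expR_oy// (integral_xexpR_sqr R).2.
rewrite mulrC /e -expRN -expRD lerD2l ler_expR; lra.
Qed.

Lemma ks_standard_normal (s : R) :
  `|fine (mu `]-oo, s]%classic) - fine (nu `]-oo, s]%classic)| <=
    3 * (b + eta).
Proof.
have eta0 : 0 < eta by exact: expR_gt0.
have close t : 0 < t -> `|\int[mu]_x cos (t * x) - \int[nu]_x cos (t * x)| <= t * B t.
  by move=> t0; rewrite cos_nu0; exact: chf_close.
have Delta s' := smoothed_cdf_dist e0 s' imu inu odd_mu odd_nu iB close.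
have DeltaB s' := le_trans (Delta s') intB.
have lip s1 t1 : s1 <= t1 ->
    fine (nu `]-oo, t1]%classic) - fine (nu `]-oo, s1]%classic) <= 1 / 2 * (t1 - s1).
  by move=> st; rewrite !nuE; [exact: normal_prob01_itv_le|exact: measurable_itv..].
apply: le_trans (cdf_dist_le_smoothed e0 eta0 DeltaB lip s) _.
have p2 := pi_ge2 R.
have p0 : 0 < pi :> R by exact: pi_gt0.
have t1 : (4 * b + eta) / pi <= (4 * b + eta) / 2.
  by rewrite ler_wpM2l ?lef_pV2 ?posrE// addr_ge0 ?mulr_ge0// ltW.
have t2 : e / (eta * pi) <= eta / 2.
  have -> : e / (eta * pi) = eta / pi.
    rewrite /e /eta (_ : - (2 * K) = - K - K); last by ring.
    by rewrite expRD invfM mulrA mulfK// gt_eqF ?expR_gt0.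
  by rewrite ler_wpM2l ?lef_pV2 ?posrE// ltW.
have := b0; move: t1 t2 eta0; rewrite -/eta.
move: (_ / pi) (e / _) => u v.
lra.
Qed.

End ks_standard_normal.

(** * Laws, moments and symmetry *)

Section laws.
Context (R : realType) (d : measure_display) (T : measurableType d) (P : probability T R).
Implicit Types (X : {RV P >-> R}) (f : R -> R).

Lemma Rintegral_distribution X f : measurable_fun setT f ->
  P.-integrable setT (EFin \o (f \o X)) ->
  \int[distribution P X]_x f x = \int[P]_x f (X x).
Proof.
move=> mf fX; congr fine; rewrite integral_distribution//.
exact/measurable_EFinP.
Qed.

Lemma integrable_distribution X f : measurable_fun setT f ->
  (distribution P X).-integrable setT (EFin \o f) <->
  P.-integrable setT (EFin \o (f \o X)).
Proof.
move=> mf.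
have mf' : measurable_fun setT (EFin \o f) by exact/measurable_EFinP.
have mfX : measurable_fun setT (EFin \o (f \o X)).
  by apply/measurable_EFinP; exact: measurableT_comp.
have eI : (\int[distribution P X]_x `|(EFin \o f) x| =
    \int[P]_x `|(EFin \o (f \o X)) x|)%E.
  by rewrite ge0_integral_distribution//; exact: measurableT_comp.
by split=> /integrableP[_ I]; apply/integrableP; split => //; rewrite ?eI// -eI.
Qed.

Lemma same_law_integral (d' : measure_display) (T' : measurableType d')
    (P' : probability T' R) X (Y : {RV P' >-> R}) (f : R -> \bar R) :
  same_law X Y -> (\int[distribution P X]_x f x = \int[distribution P' Y]_x f x)%E.
Proof. by move=> XY; apply: eq_measure_integral => A mA _; exact: XY. Qed.

(** Symmetry equates the integral of f with that of f (- x) = - f x. *)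
Lemma symmetric_Rintegral_odd X f : symmetric_rv X -> measurable_fun setT f ->
  (forall x, f (- x) = - f x) -> P.-integrable setT (EFin \o (f \o X)) ->
  \int[distribution P X]_x f x = 0.
Proof.
move=> symX mf oddf iX.
have iNX : P.-integrable setT (EFin \o (f \o (- (X : {mfun T >-> R}) : {RV P >-> R}))).
  rewrite (_ : _ \o _ = fun x => (((-1)%:E * (EFin \o (f \o X)) x)%E)).
    exact: integrableZl.
  by apply/funext => x /=; rewrite oddf EFinN mulN1e.
have : \int[distribution P X]_x f x = - \int[distribution P X]_x f x.
  rewrite {1}/Rintegral -(same_law_integral _ symX) -/(Rintegral _ _ _).
  rewrite !Rintegral_distribution//.
  under eq_Rintegral do rewrite /= oddf -mulN1r.
  by rewrite RintegralZl// mulN1r.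
lra.
Qed.

Lemma normalized_sumE (N : nat) (Xs : 'I_N -> {RV P >-> R}) x :
  normalized_sum Xs x = (Num.sqrt N%:R)^-1 * \sum_(i < N) Xs i x.
Proof.
rewrite /normalized_sum /=; congr (_ * _).
elim/big_ind2 : _ => //=.
by move=> f r g s <- <-.
Qed.

Lemma ks_dist_le (d' : measure_display) (T' : measurableType d')
    (P' : probability T' R) X (Y : {RV P' >-> R}) (c : R) :
  (forall s, `|fine (cdf X s) - fine (cdf Y s)| <= c) -> ks_dist X Y <= c.
Proof.
move=> h; apply: ge_sup; first by exists `|fine (cdf X 0) - fine (cdf Y 0)|, 0.
by move=> _ [s _ <-].
Qed.

Lemma ks_dist_le1 (d' : measure_display) (T' : measurableType d')
    (P' : probability T' R) X (Y : {RV P' >-> R}) : ks_dist X Y <= 1.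
Proof.
apply: ks_dist_le => s.
have u01 (mu : probability R R) : 0 <= fine (mu `]-oo, s]%classic) <= 1.
  have mI : measurable (`]-oo, s]%classic : set R) by exact: measurable_itv.
  rewrite fine_ge0// -lee_fin fineK ?fin_num_measure//.
  exact: probability_le1.
have := u01 (distribution P X); have := u01 (distribution P' Y).
by rewrite /cdf ler_norml => /andP[? ?] /andP[? ?]; apply/andP; split; lra.
Qed.

End laws.

Section moments.
Context (R : realType) (d : measure_display) (T : measurableType d) (P : probability T R).
Variable X : {RV P >-> R}.
Hypotheses (symX : symmetric_rv X) (var1 : 'V_P[X] = 1%E).
Hypothesis m4 : ('E_P[fun t => (X t ^+ 4)%R] < +oo)%E.
Let mu := distribution P X.

Let iX4 : P.-integrable setT (EFin \o ((fun x : R => x ^+ 4) \o X)).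
Proof.
apply/integrableP; split.
  by apply/measurable_EFinP => /=; apply: measurable_funX.
move: m4; rewrite unlock; congr (_ < _)%E.
apply: eq_integral => x _ /=; rewrite ger0_norm//.
by rewrite (exprM _ 2 2) sqr_ge0.
Qed.

Let iX1 : P.-integrable setT (EFin \o X).
Proof.
have i1 : P.-integrable setT (EFin \o (fun=> 1 : R)).
  by apply: (integrable_of_bounded _ (M := 1)) => // x; rewrite normr1.
apply: le_integrable (integrableD measurableT i1 iX4) => //.
  exact/measurable_EFinP.
move=> x _ /=; rewrite lee_fin [leRHS]ger0_norm; last first.
  by rewrite addr_ge0// (exprM _ 2 2) sqr_ge0.
have := sqr_ge0 (X x ^+ 2 - 1 / 2); have := sqr_ge0 (X x - 1 / 2).
have := sqr_ge0 (X x + 1 / 2).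
rewrite ler_norml !sqrrD -exprM => ? ? ?; apply/andP; split; lra.
Qed.

Lemma integrable_distribution_X4 : mu.-integrable setT (EFin \o (fun x : R => x ^+ 4)).
Proof. by apply/integrable_distribution => //; exact: exprn_measurable. Qed.

Lemma integrable_distribution_normr : mu.-integrable setT (EFin \o (fun x : R => `|x|)).
Proof. by apply/integrable_distribution => //; exact: (integrable_norm iX1). Qed.

Lemma fine_expectation_X4 : fine 'E_P[fun t => (X t ^+ 4)%R]%E = \int[mu]_x x ^+ 4.
Proof.
rewrite Rintegral_distribution//.
by rewrite unlock.
Qed.

(** By symmetry the mean vanishes, so the variance is the second moment. *)
Lemma symmetric_variance : \int[mu]_x x ^+ 2 = 1.
Proof.
have EX : ('E_P[X] = 0)%E.
  have fE : ('E_P[X] \is a fin_num)%E by rewrite unlock; exact: integrable_fin_num.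
  rewrite -(fineK fE); congr EFin.
  rewrite -[RHS](symmetric_Rintegral_odd (f := id) symX)//.
  by rewrite Rintegral_distribution// unlock.
have : \int[mu]_x x ^+ 2 = fine ('V_P[X])%E.
  rewrite /variance [in RHS]covariance.unlock EX expectation.unlock /= /Rintegral; congr fine.
  rewrite ge0_integral_distribution//=.
  - apply: eq_integral => x _; rewrite -[RHS]/((X x - 0) * (X x - 0))%:E.
    by rewrite !subr0.
  - by apply/measurable_EFinP; exact: exprn_measurable.
  - by move=> x; rewrite lee_fin sqr_ge0.
by rewrite var1.
Qed.

End moments.

(** * The Berry-Esseen type bound *)

Theorem corollary1p2 (R : realType)
    (d d' d'' : measure_display)
    (T : measurableType d) (T' : measurableType d') (T'' : measurableType d'')
    (P : probability T R) (P' : probability T' R) (P'' : probability T'' R)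
    (X : {RV P >-> R}) (h w : R)
    (N : nat) (Xs : 'I_N -> {RV P' >-> R}) (G : {RV P'' >-> R}) :
  0 < h <= 1 -> 0 < w <= 1 ->
  symmetric_rv X ->
  ('V_P[X] = 1)%E ->
  ('E_P[fun t => (X t ^+ 4)%R] < +oo)%E ->
  assumption1 h w (distribution P X) ->
  (1 <= N)%N ->
  independent_rvs Xs ->
  (forall i, same_law (Xs i) X) ->
  standard_gaussian G ->
  let m4 := fine 'E_P[fun t => (X t ^+ 4)%R]%E in
  ks_dist (normalized_sum Xs) G
    <= 3 * (m4 / N%:R + expR (- (160^-1 * (h * w ^+ 3 * N%:R / m4)))).
Proof.
move=> h01 w01 symX var1 EX4 hw N1 indXs lawXs gaussG /=.
rewrite fine_expectation_X4//; set mu := distribution P X; set m := \int[mu]_x x ^+ 4.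
have i4 := integrable_distribution_X4 EX4; have v1 := symmetric_variance symX var1 EX4.
have m1 : 1 <= m := fourth_moment_ge1 i4 v1.
have m0 : 0 < m := lt_le_trans ltr01 m1.
have N0 : 0 < N%:R :> R by rewrite ltr0n.
have mN0 : 0 <= m / N%:R by rewrite divr_ge0// ltW.
have [mN|Nm] := ltP (3 * m) N%:R; last first.
  apply: le_trans (ks_dist_le1 _ _) _.
  rewrite mulrDr -[leLHS]addr0 lerD// ?mulr_ge0 ?expR_ge0//.
  by rewrite mulrA ler_pdivlMr// mul1r.
have mcos t : measurable_fun setT (fun x : R => cos (t * x)).
  by apply: measurable_cos; exact: measurable_funM.
have msin t : measurable_fun setT (fun x : R => sin (t * x)).
  by apply: measurable_sin; exact: measurable_funM.
have RintXs i (f : R -> R) : measurable_fun setT f -> (forall x, `|f x| <= 1) ->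
    \int[P']_x f (Xs i x) = \int[mu]_x f x.
  move=> mf f1; rewrite -Rintegral_distribution//.
    by congr fine; exact: same_law_integral.
  apply: (integrable_of_bounded _ (M := 1)) => [|x]; last exact: f1.
  exact: measurableT_comp.
have sin0 t : \int[mu]_x sin (t * x) = 0.
  apply: symmetric_Rintegral_odd => // [x|]; first by rewrite mulrN sinN.
  apply: (integrable_of_bounded _ (M := 1)) => [|x]; last exact: sin_max.
  by apply: measurableT_comp => //; exact: msin.
have chfS t a : \int[P']_x cos (t * \sum_(i < N) Xs i x + a) =
    (\int[mu]_x cos (t * x)) ^+ N * cos a.
  apply: Rintegral_cos_independent_sum => // i.
    by rewrite (RintXs i (fun x => cos (t * x)))// => x; exact: cos_max.
  by rewrite (RintXs i (fun x => sin (t * x)))// => x; exact: sin_max.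
set S := normalized_sum Xs.
have ibndS (f : R -> R) : measurable_fun setT f -> (forall x, `|f x| <= 1) ->
    P'.-integrable setT (EFin \o (f \o S)).
  move=> mf f1; apply: (integrable_of_bounded _ (M := 1)) => [|x]; last exact: f1.
  exact: measurableT_comp.
have cosS t : \int[distribution P' S]_x cos (t * x) =
    (\int[mu]_x cos (t / Num.sqrt N%:R * x)) ^+ N.
  rewrite Rintegral_distribution//; last by apply: ibndS => // x; exact: cos_max.
  rewrite -[RHS]mulr1 -[X in _ * X](@cos0 R) -chfS; apply: eq_Rintegral => x _.
  by rewrite normalized_sumE mulrA addr0.
(* the sine is the cosine with phase - pi / 2, whose cosine is 0 *)
have sinS t : \int[distribution P' S]_x sin (t * x) = 0.
  rewrite Rintegral_distribution//; last by apply: ibndS => // x; exact: sin_max.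
  rewrite -[RHS](mulr0 ((\int[mu]_x cos (t / Num.sqrt N%:R * x)) ^+ N)).
  rewrite -[X in _ * X](cos_pihalf R) -cosN -chfS; apply: eq_Rintegral => x _.
  by rewrite normalized_sumE mulrA cosBpihalf.
have iS : (distribution P' S).-integrable setT (EFin \o (fun x : R => `|x|)).
  apply/integrable_distribution => //.
  have iXs i : P'.-integrable setT (EFin \o Xs i).
    apply/(integrable_distribution (Xs i) (f := id)) => //.
    apply/integrableP; split; first exact/measurable_EFinP.
    rewrite (same_law_integral _ (lawXs i)).
    have /integrableP[_] := integrable_distribution_normr EX4.
    by congr (_ < _)%E; apply: eq_integral => x _ /=; rewrite normr_id.
  apply: (integrable_norm (f := S)).
  have := integrableZl measurableT (Num.sqrt N%:R)^-1
    (integrable_sum measurableT (index_enum 'I_N) (P := xpredT) (fun i _ => iXs i)).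
  by congr integrable; apply/funext => x; rewrite -[RHS]/((normalized_sum Xs x)%:E) normalized_sumE EFinM -sumEFin.
apply: ks_dist_le => s.
apply: (ks_standard_normal mN0 iS sinS _ gaussG) => t t0.
have := chf_power_close m1 mN (chf_taylor i4 v1)
  (fun u => @normr_chf_away0 _ _ _ _ h01 w01 _ u hw m1) t0.
rewrite cosS; congr (_ <= _ * (_ + expR (- _))).
by field; rewrite !gt_eqF.
Qed.
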